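(* (a) Let $q_0>q_2$ be the constant of the flux condition in problem (P3), and let $\lambda_2$ be the corresponding coefficient of the solution of (P3). Then the solution of problem (P2) with $$A=B+\frac{q_0\sqrt{\pi\alpha_3}}{k_3}\operatorname{erf}\left(\lambda_2\sqrt{\frac{\alpha_1}{\alpha_3}}\right)$$ coincides with the solution of problem (P3). (b) Let $A>B$ be the datum of the temperature condition in problem (P2), and let $\mu_2$ be the corresponding coefficient of the solution of (P2). If $$\frac{k_3(A-B)}{\sqrt{\alpha_3}\operatorname{erf}\left(\mu_2\sqrt{\frac{\alpha_1}{\alpha_3}}\right)}>\frac{k_2(B-C)}{\sqrt{\alpha_2}\operatorname{erf}\left(z_0\sqrt{\frac{\alpha_1}{\alpha_2}}\right)},$$ then the solution of problem (P3) with $$q_0=\frac{k_3}{\sqrt{\pi\alpha_3}}\,\frac{A-B}{\operatorname{erf}\left(\mu_2\sqrt{\frac{\alpha_1}{\alpha_3}}\right)}$$ coincides with the solution of problem (P2).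
   Context: Data: positive constants $\rho$, $k_i,c_i$ ($i=1,2,3$), $\ell_1,\ell_2$; $\alpha_i=\frac{k_i}{\rho c_i}$, $\delta_i=\rho\ell_i$ ($i=1,2$); it is assumed that $\alpha_2>\alpha_3$. Real temperatures $B>C>D$. Common system (S): find $\Phi_3$ (on $0<x<y_2(t)$), $\Phi_2$ (on $y_2(t)<x<y_1(t)$), $\Phi_1$ (on $x>y_1(t)$) and free boundaries $y_1,y_2$ such that, for $t>0$: $\partial_t\Phi_i=\alpha_i\partial_{xx}\Phi_i$ in the respective region; $\Phi_3(y_2(t),t)=\Phi_2(y_2(t),t)=B$; $\Phi_2(y_1(t),t)=\Phi_1(y_1(t),t)=C$; $\Phi_1(x,0)=\Phi_1(+\infty,t)=D$ (as limits); $k_2\partial_x\Phi_2(y_2(t),t)-k_3\partial_x\Phi_3(y_2(t),t)=\delta_2\dot y_2(t)$; $k_1\partial_x\Phi_1(y_1(t),t)-k_2\partial_x\Phi_2(y_1(t),t)=\delta_1\dot y_1(t)$; $y_1(0)=y_2(0)=0$. (P2) is (S) with $\Phi_3(0,t)=A$, $t>0$, where $A>B$. (P3) is (S) with $k_3\partial_x\Phi_3(0,t)=-\frac{q_0}{\sqrt t}$, $t>0$, where $q_0>0$. ''The solution'' means the unique similarity-type solution, i.e. of the form $\Phi_i=A_i+B_i\operatorname{erf}\left(\frac{x}{2\sqrt{\alpha_it}}\right)$ with real constants $A_i,B_i$ and $y_i(t)=2\eta_i\sqrt{\alpha_1t}$ with $0<\eta_2<\eta_1$. Two solutions coincide if their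 free boundaries and all three temperatures are equal. Functions: $\operatorname{erf}^{-1}:(-1,1)\to\mathbb R$ is the inverse of $\operatorname{erf}$, $\operatorname{erfc}=1-\operatorname{erf}$, $\mathrm{Ste}_1=\frac{c_1(C-D)}{\ell_1}$, $\mathrm{Ste}_2=\frac{c_2(B-C)}{\ell_2}$, and $$\varphi(z)=z+\frac{\mathrm{Ste}_1}{\sqrt\pi}\frac{\exp(-z^2)}{\operatorname{erfc}(z)},\qquad H(z)=\operatorname{erf}\left(z\sqrt{\tfrac{\alpha_1}{\alpha_2}}\right)-\frac{\mathrm{Ste}_2}{\sqrt\pi}\frac{\ell_2}{\ell_1}\sqrt{\frac{k_2c_1}{k_1c_2}}\,\frac{\exp\left(-z^2\frac{\alpha_1}{\alpha_2}\right)}{\varphi(z)},$$ $$Q(z)=\frac{\ell_1}{\ell_2}\varphi(z)\exp\left(z^2\tfrac{\alpha_1}{\alpha_2}\right)\qquad(z\ge0),$$ $$V(z)=\frac{A-B}{\ell_2}\sqrt{\frac{c_1c_3k_3}{\pi k_1}}\;\frac{\exp\left(-z^2\left(\frac{\alpha_1}{\alpha_3}-\frac{\alpha_1}{\alpha_2}\right)\right)}{\operatorname{erf}\left(z\sqrt{\frac{\alpha_1}{\alpha_3}}\right)}-z\exp\left(z^2\tfrac{\alpha_1}{\alpha_2}\right)\qquad(z>0),$$ $$P(z)=\exp\left(z^2\tfrac{\alpha_1}{\alpha_2}\right)\left[-z+\frac{q_0}{\ell_2}\sqrt{\frac{c_1}{\rho k_1}}\exp\left(-z^2\tfrac{\alpha_1}{\alpha_3}\right)\right]\qquad(z\ge0).$$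 $z_0>0$ is the unique zero of the increasing function $H$, and $q_2=\frac{k_2(B-C)}{\sqrt{\alpha_2\pi}\operatorname{erf}(z_0\sqrt{\alpha_1/\alpha_2})}$. Write $g(z)=\sqrt{\frac{\alpha_2}{\alpha_1}}\operatorname{erf}^{-1}(H(z))$ for $z\ge z_0$. Solution of (P2), existing and unique for $A>B$: free boundaries $r_i(t)=2\mu_i\sqrt{\alpha_1t}$, where $\mu_1$ is the unique solution in $(z_0,\infty)$ of $Q(z)=V(g(z))$ and $\mu_2=g(\mu_1)$; temperatures $u_3=A-(A-B)\dfrac{\operatorname{erf}\left(\frac{x}{2\sqrt{\alpha_3t}}\right)}{\operatorname{erf}(\mu_2\sqrt{\alpha_1/\alpha_3})}$, $u_2=C+(B-C)\dfrac{\operatorname{erf}(\mu_1\sqrt{\alpha_1/\alpha_2})-\operatorname{erf}\left(\frac{x}{2\sqrt{\alpha_2t}}\right)}{\operatorname{erf}(\mu_1\sqrt{\alpha_1/\alpha_2})-\operatorname{erf}(\mu_2\sqrt{\alpha_1/\alpha_2})}$, $u_1=D+(C-D)\dfrac{\operatorname{erfc}\left(\frac{x}{2\sqrt{\alpha_1t}}\right)}{\operatorname{erfc}(\mu_1)}$. Solution of (P3), existing and unique for $q_0>q_2$: free boundaries $s_i(t)=2\lambda_i\sqrt{\alpha_1t}$, where $\lambda_1$ is the unique solution in $(z_0,\infty)$ of $Q(z)=P(g(z))$ and $\lambda_2=g(\lambda_1)$; temperatures $\theta_3=B+\frac{q_0\sqrt{\pi\alpha_3}}{k_3}\left(\operatorname{erf}(\lambda_2\sqrt{\alpha_1/\alpha_3})-\operatorname{erf}\left(\frac{x}{2\sqrt{\alpha_3t}}\right)\right)$,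 and $\theta_2,\theta_1$ given by the formulas for $u_2,u_1$ with $\mu_i$ replaced by $\lambda_i$. *)

(* Defs.v *)
From Stdlib Require Import Reals.
From Coquelicot Require Import Coquelicot.
Open Scope R_scope.

(** * Error function *)

Definition erf (x : R) : R :=
  2 / sqrt PI * RInt (fun s => exp (- s ^ 2)) 0 x.

Definition erfc (x : R) : R := 1 - erf x.

(** * Physical data *)

(** [tempB], [tempC] are the two phase-change temperatures and [tempD] the
    initial temperature; [l1], [l2] are the latent heats. *)
Record data : Type := Data {
  rho : R;
  k1 : R; k2 : R; k3 : R;
  c1 : R; c2 : R; c3 : R;
  l1 : R; l2 : R;
  tempB : R; tempC : R; tempD : R
}.

Definition alpha1 (d : data) : R := k1 d / (rho d * c1 d).
Definition alpha2 (d : data) : R := k2 d / (rho d * c2 d).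
Definition alpha3 (d : data) : R := k3 d / (rho d * c3 d).
Definition delta1 (d : data) : R := rho d * l1 d.
Definition delta2 (d : data) : R := rho d * l2 d.

Record admissible (d : data) : Prop := {
  rho_pos : 0 < rho d;
  k1_pos : 0 < k1 d; k2_pos : 0 < k2 d; k3_pos : 0 < k3 d;
  c1_pos : 0 < c1 d; c2_pos : 0 < c2 d; c3_pos : 0 < c3 d;
  l1_pos : 0 < l1 d; l2_pos : 0 < l2 d;
  alpha3_lt_alpha2 : alpha3 d < alpha2 d;
  tempC_lt_tempB : tempC d < tempB d;
  tempD_lt_tempC : tempD d < tempC d
}.

(** * The free boundary problems *)

(** Temperatures are total functions of [(x, t)]; only their values on the
    closures of their own phases, for [t > 0], are meaningful.  The free
    boundaries are meaningful for [t >= 0]. *)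
Record candidate : Type := Candidate {
  Phi1 : R -> R -> R;
  Phi2 : R -> R -> R;
  Phi3 : R -> R -> R;
  y1 : R -> R;
  y2 : R -> R
}.

(** Each phase is known on one side of a boundary only, so the space
    derivatives there are one-sided. *)
Definition is_left_derive (f : R -> R) (a l : R) : Prop :=
  filterlim (fun x => (f x - f a) / (x - a)) (at_left a) (locally l).
Definition is_right_derive (f : R -> R) (a l : R) : Prop :=
  filterlim (fun x => (f x - f a) / (x - a)) (at_right a) (locally l).

Definition heat_equation (alpha : R) (Phi : R -> R -> R)
    (region : R -> R -> Prop) : Prop :=
  forall x t, 0 < t -> region x t ->
    ex_derive (fun s => Phi x s) t /\
    ex_derive (fun z => Phi z t) x /\
    ex_derive_n (fun z => Phi z t) 2 x /\
    Derive (fun s => Phi x s) t = alpha * Derive_n (fun z => Phi z t) 2 x.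

Definition stefan_condition (kr kl delta : R) (Phir Phil : R -> R -> R)
    (y : R -> R) : Prop :=
  forall t, 0 < t -> exists pr pl v,
    is_right_derive (fun x => Phir x t) (y t) pr /\
    is_left_derive (fun x => Phil x t) (y t) pl /\
    is_derive y t v /\
    kr * pr - kl * pl = delta * v.

Record common_system (d : data) (s : candidate) : Prop := {
  heat3 : heat_equation (alpha3 d) (Phi3 s) (fun x t => 0 < x < y2 s t);
  heat2 : heat_equation (alpha2 d) (Phi2 s) (fun x t => y2 s t < x < y1 s t);
  heat1 : heat_equation (alpha1 d) (Phi1 s) (fun x t => y1 s t < x);
  value_y2 : forall t, 0 < t ->
    Phi3 s (y2 s t) t = tempB d /\ Phi2 s (y2 s t) t = tempB d;
  value_y1 : forall t, 0 < t ->
    Phi2 s (y1 s t) t = tempC d /\ Phi1 s (y1 s t) t = tempC d;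
  initial : forall x, 0 < x ->
    filterlim (fun t => Phi1 s x t) (at_right 0) (locally (tempD d));
  far_field : forall t, 0 < t ->
    is_lim (fun x => Phi1 s x t) p_infty (tempD d);
  stefan2 : stefan_condition (k2 d) (k3 d) (delta2 d) (Phi2 s) (Phi3 s) (y2 s);
  stefan1 : stefan_condition (k1 d) (k2 d) (delta1 d) (Phi1 s) (Phi2 s) (y1 s);
  start : y1 s 0 = 0 /\ y2 s 0 = 0
}.

(** Temperature [tempA] at the fixed face, attained continuously. *)
Definition P2 (d : data) (tempA : R) (s : candidate) : Prop :=
  common_system d s /\
  forall t, 0 < t ->
    Phi3 s 0 t = tempA /\
    filterlim (fun x => Phi3 s x t) (at_right 0) (locally tempA).

Definition P3 (d : data) (q0 : R) (s : candidate) : Prop :=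
  common_system d s /\
  forall t, 0 < t -> exists p,
    is_right_derive (fun x => Phi3 s x t) 0 p /\
    k3 d * p = - (q0 / sqrt t).

(** * Similarity solutions *)

Definition similarity_type (d : data) (eta1 eta2 : R) (s : candidate) : Prop :=
  0 < eta2 < eta1 /\
  (forall t, 0 <= t -> y1 s t = 2 * eta1 * sqrt (alpha1 d * t)) /\
  (forall t, 0 <= t -> y2 s t = 2 * eta2 * sqrt (alpha1 d * t)) /\
  (exists a b, forall x t, 0 < t -> 0 <= x <= y2 s t ->
     Phi3 s x t = a + b * erf (x / (2 * sqrt (alpha3 d * t)))) /\
  (exists a b, forall x t, 0 < t -> y2 s t <= x <= y1 s t ->
     Phi2 s x t = a + b * erf (x / (2 * sqrt (alpha2 d * t)))) /\
  (exists a b, forall x t, 0 < t -> y1 s t <= x ->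
     Phi1 s x t = a + b * erf (x / (2 * sqrt (alpha1 d * t)))).

(** Once the free boundaries agree the phases of [s] and [s'] agree too, so
    that those of [s] can be used to compare the temperatures. *)
Definition coincide (s s' : candidate) : Prop :=
  (forall t, 0 <= t -> y1 s t = y1 s' t) /\
  (forall t, 0 <= t -> y2 s t = y2 s' t) /\
  (forall x t, 0 < t -> 0 <= x <= y2 s t -> Phi3 s x t = Phi3 s' x t) /\
  (forall x t, 0 < t -> y2 s t <= x <= y1 s t -> Phi2 s x t = Phi2 s' x t) /\
  (forall x t, 0 < t -> y1 s t <= x -> Phi1 s x t = Phi1 s' x t).

(** [s] is the solution of similarity type of problem [P], unique up to
    [coincide], and [eta1], [eta2] are the coefficients of its free
    boundaries. *)
Definition the_solution (d : data) (P : candidate -> Prop)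
    (s : candidate) (eta1 eta2 : R) : Prop :=
  similarity_type d eta1 eta2 s /\ P s /\
  forall s' eta1' eta2',
    similarity_type d eta1' eta2' s' -> P s' -> coincide s s'.

(** * The threshold flux *)

Definition Ste1 (d : data) : R := c1 d * (tempC d - tempD d) / l1 d.
Definition Ste2 (d : data) : R := c2 d * (tempB d - tempC d) / l2 d.

Definition phi (d : data) (z : R) : R :=
  z + Ste1 d / sqrt PI * (exp (- z ^ 2) / erfc z).

Definition H (d : data) (z : R) : R :=
  erf (z * sqrt (alpha1 d / alpha2 d))
  - Ste2 d / sqrt PI * (l2 d / l1 d) * sqrt (k2 d * c1 d / (k1 d * c2 d))
    * (exp (- (z ^ 2 * (alpha1 d / alpha2 d))) / phi d z).

(** Meant for [z0] the positive zero of [H d]. *)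
Definition q2 (d : data) (z0 : R) : R :=
  k2 d * (tempB d - tempC d)
  / (sqrt (alpha2 d * PI) * erf (z0 * sqrt (alpha1 d / alpha2 d))).

(* Main.v *)
Require Import Defs.
From Stdlib Require Import Reals Lra.
From Coquelicot Require Import Coquelicot.
(* [Reals] hides the projection [c1]. *)
Import Defs.
Open Scope R_scope.

(** For a similarity-type candidate every condition of the free boundary
    problem is algebraic.  With [x], [y] the coefficients of the boundaries and
    [q / sqrt t] the flux entering at [x = 0], eliminating the constants of the
    profiles leaves [erf (y sqrt (alpha1 / alpha2)) = H x] and the second Stefan
    condition, in which the fixed face enters only through [q]: (P3) prescribes
    [q], while (P2) prescribes [q erf (y sqrt (alpha1 / alpha3))].  The first
    equation makes [y] an increasing function of [x]; since [alpha3 < alpha2],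
    the two sides of the second one are then monotone in opposite directions,
    which gives uniqueness, and existence is the intermediate value theorem
    starting at [z0].  The solution of either problem thus has a triple
    [(x, y, q)] which is also that of the other problem for the matching datum,
    so one candidate solves both. *)

(** * The error function *)

Lemma exp_nondecreasing (x y : R) : x <= y -> exp x <= exp y.
Proof.
  intros [Hxy| ->]; [left; now apply exp_increasing | right; reflexivity].
Qed.

Lemma continuous_gaussian (x : R) : continuous (fun s => exp (- s ^ 2)) x.
Proof.
  apply (ex_derive_continuous (fun s => exp (- s ^ 2))); auto_derive; trivial.
Qed.

Lemma is_derive_RInt_gaussian (x : R) :
  is_derive (fun z => RInt (fun s => exp (- s ^ 2)) 0 z) x (exp (- x ^ 2)).
Proof.
  apply (is_derive_RInt (fun s => exp (- s ^ 2)) _ 0 x).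
  - apply filter_forall; intros z.
    apply (RInt_correct (V := R_CompleteNormedModule)).
    apply (ex_RInt_continuous (V := R_CompleteNormedModule)).
    intros; apply continuous_gaussian.
  - apply continuous_gaussian.
Qed.

Lemma is_derive_erf (x : R) : is_derive erf x (2 / sqrt PI * exp (- x ^ 2)).
Proof.
  unfold erf.
  exact (is_derive_scal _ x (2 / sqrt PI) _ (is_derive_RInt_gaussian x)).
Qed.

(* eta-expanded, which is the form that [auto_derive] leaves *)
Lemma Derive_erf (x : R) : Derive (fun z => erf z) x = 2 / sqrt PI * exp (- x ^ 2).
Proof. apply is_derive_unique, is_derive_erf. Qed.

Lemma sqrt_PI_pos : 0 < sqrt PI.
Proof. apply sqrt_lt_R0, PI_RGT_0. Qed.

Lemma erf_0 : erf 0 = 0.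
Proof. unfold erf; rewrite RInt_point; unfold zero; simpl; ring. Qed.

Lemma erf_increasing (x y : R) : x < y -> erf x < erf y.
Proof.
  intros Hxy.
  apply (incr_function erf m_infty p_infty (fun z => 2 / sqrt PI * exp (- z ^ 2)));
    try easy.
  - intros; apply is_derive_erf.
  - intros; pose proof sqrt_PI_pos; pose proof (exp_pos (- x0 ^ 2)).
    apply Rmult_lt_0_compat; [apply Rdiv_lt_0_compat|]; lra.
Qed.

Lemma erf_le_inv (x y : R) : erf x <= erf y -> x <= y.
Proof.
  intros Hxy; destruct (Rle_or_lt x y) as [|Hc]; trivial.
  apply erf_increasing in Hc; lra.
Qed.

Lemma erf_lt_inv (x y : R) : erf x < erf y -> x < y.
Proof.
  intros Hxy; destruct (Rlt_or_le x y) as [|[Hc| ->]]; trivial; [|lra].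
  apply erf_increasing in Hc; lra.
Qed.

Lemma erf_inj (x y : R) : erf x = erf y -> x = y.
Proof. intros E; apply Rle_antisym; apply erf_le_inv; lra. Qed.

Lemma erf_pos (x : R) : 0 < x -> 0 < erf x.
Proof. intros Hx; rewrite <- erf_0; now apply erf_increasing. Qed.

(** * The Gaussian integral and the limit of [erf] at infinity *)

Lemma is_derive_gaussian_param (x s : R) :
  is_derive (fun u => exp (- u ^ 2 * (1 + s ^ 2)) / (1 + s ^ 2)) x
    (- 2 * x * exp (- x ^ 2 * (1 + s ^ 2))).
Proof.
  auto_derive; [nra|]. simpl; field; nra.
Qed.

Lemma ex_RInt_gaussian_param (x : R) :
  ex_RInt (fun s => exp (- x ^ 2 * (1 + s ^ 2)) / (1 + s ^ 2)) 0 1.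
Proof.
  apply (ex_RInt_continuous (fun s => exp (- x ^ 2 * (1 + s ^ 2)) / (1 + s ^ 2))).
  intros z _.
  apply (ex_derive_continuous
    (fun s => exp (- x ^ 2 * (1 + s ^ 2)) / (1 + s ^ 2))).
  auto_derive; nra.
Qed.

(** Differentiating under the integral sign cancels the denominator [1 + s ^ 2]; the factor
    [exp (- x ^ 2)] comes out and the substitution [x * s] leaves the Gaussian integral over
    [[0, x]]. The result is minus the derivative of the square of that integral. *)
Lemma is_derive_RInt_gaussian_param (x : R) :
  is_derive (fun u => RInt (fun s => exp (- u ^ 2 * (1 + s ^ 2)) / (1 + s ^ 2)) 0 1)
    x (- 2 * exp (- x ^ 2) * RInt (fun s => exp (- s ^ 2)) 0 x).
Proof.
  replace (- 2 * exp (- x ^ 2) * RInt (fun s => exp (- s ^ 2)) 0 x)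
    with (RInt (fun t => Derive
      (fun u => exp (- u ^ 2 * (1 + t ^ 2)) / (1 + t ^ 2)) x) 0 1).
  - apply is_derive_RInt_param.
    + apply filter_forall; intros u s _; eexists; apply is_derive_gaussian_param.
    + intros s _.
      apply continuity_2d_pt_ext with (fun u v => - 2 * u * exp (- u ^ 2 * (1 + v ^ 2))).
      { intros u v; symmetry; apply is_derive_unique, is_derive_gaussian_param. }
      apply continuity_2d_pt_mult.
      * apply continuity_2d_pt_mult;
          [apply continuity_2d_pt_const | apply continuity_2d_pt_id1].
      * apply (continuity_1d_2d_pt_comp exp (fun u v => - u ^ 2 * (1 + v ^ 2))).
        { apply derivable_continuous_pt, derivable_pt_exp. }
        apply continuity_2d_pt_ext with (fun u v => - (u * u) * (1 + v * v)).
        { intros; ring. }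
        apply continuity_2d_pt_mult.
        -- apply continuity_2d_pt_opp, continuity_2d_pt_mult;
             apply continuity_2d_pt_id1.
        -- apply continuity_2d_pt_plus; [apply continuity_2d_pt_const|].
           apply continuity_2d_pt_mult; apply continuity_2d_pt_id2.
    + apply filter_forall; intros; apply ex_RInt_gaussian_param.
  - rewrite (RInt_ext _ (fun s => scal (- 2 * exp (- x ^ 2))
                                    (scal x (exp (- (x * s + 0) ^ 2))))).
    + rewrite (RInt_scal (fun s => scal x (exp (- (x * s + 0) ^ 2)))).
      * rewrite (RInt_comp_lin (fun s => exp (- s ^ 2))).
        -- rewrite Rmult_0_r, Rmult_1_r, Rplus_0_l, Rplus_0_r; reflexivity.
        -- apply (ex_RInt_continuous (V := R_CompleteNormedModule)).
           intros; apply continuous_gaussian.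
      * apply (ex_RInt_continuous (V := R_CompleteNormedModule)); intros z _.
        apply (ex_derive_continuous (fun s => scal x (exp (- (x * s + 0) ^ 2)))).
        unfold scal; simpl; unfold mult; simpl; auto_derive; trivial.
    + intros s _.
      etransitivity; [apply is_derive_unique, is_derive_gaussian_param|].
      unfold scal; simpl; unfold mult; simpl.
      replace (- (x * (x * 1)) * (1 + s * (s * 1))) with
        (- (x * (x * 1)) + - ((x * s + 0) * ((x * s + 0) * 1))) by ring.
      rewrite exp_plus; ring.
Qed.

(** The sum has derivative zero, so it equals its value at [0], which is the integral of
    [/ (1 + s ^ 2)] over [[0, 1]], an arctangent. *)
Lemma RInt_gaussian_sqr (x : R) :
  RInt (fun s => exp (- s ^ 2)) 0 x ^ 2
  + RInt (fun s => exp (- x ^ 2 * (1 + s ^ 2)) / (1 + s ^ 2)) 0 1 = PI / 4.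
Proof.
  set (F := fun x => RInt (fun s => exp (- s ^ 2)) 0 x ^ 2
    + RInt (fun s => exp (- x ^ 2 * (1 + s ^ 2)) / (1 + s ^ 2)) 0 1).
  assert (HF : forall z, is_derive F z 0).
  { intros z; unfold F.
    evar_last.
    - apply (is_derive_plus (fun x => RInt (fun s => exp (- s ^ 2)) 0 x ^ 2)).
      + apply is_derive_pow, is_derive_RInt_gaussian.
      + apply is_derive_RInt_gaussian_param.
    - unfold plus; simpl; ring. }
  change (F x = PI / 4).
  assert (E : F x = F 0).
  { destruct (MVT_gen F 0 x (fun _ => 0)) as [c [_ Hc]].
    - intros; apply HF.
    - intros; apply continuity_pt_filterlim.
      apply (ex_derive_continuous F); eexists; apply HF.
    - lra. }
  rewrite E; unfold F; rewrite RInt_point.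
  rewrite (RInt_ext _ (fun s => / (1 + s ^ 2))).
  - rewrite (is_RInt_unique _ _ _ (atan 1 - atan 0)).
    + rewrite atan_0, atan_1; unfold zero; simpl; ring.
    + apply (is_RInt_derive atan).
      * intros; apply is_derive_Reals, derivable_pt_lim_atan.
      * intros; apply (ex_derive_continuous (fun s => / (1 + s ^ 2))).
        auto_derive; nra.
  - intros; simpl. replace (- (0 * (0 * 1)) * (1 + x0 * (x0 * 1))) with 0 by ring.
    rewrite exp_0; field; nra.
Qed.

(** The deficit of [erf x ^ 2] from [1] is [4 / PI] times the parametric integral [G], which is
    positive and, since [1 + s ^ 2 >= 1], at most [exp (- x ^ 2)]. *)
Lemma erf_sqr_bounds (x : R) : 1 - 4 / PI * exp (- x ^ 2) <= erf x ^ 2 < 1.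
Proof.
  pose proof PI_RGT_0 as HPI.
  set (G := RInt (fun s => exp (- x ^ 2 * (1 + s ^ 2)) / (1 + s ^ 2)) 0 1).
  assert (E : erf x ^ 2 = 1 - 4 / PI * G).
  { unfold erf; rewrite Rpow_mult_distr.
    replace ((2 / sqrt PI) ^ 2) with (4 / (sqrt PI * sqrt PI)).
    - rewrite sqrt_sqrt by lra.
      pose proof (RInt_gaussian_sqr x) as Hsqr; fold G in Hsqr.
      replace (RInt (fun s => exp (- s ^ 2)) 0 x ^ 2) with (PI / 4 - G) by lra.
      field; lra.
    - pose proof sqrt_PI_pos; field; lra. }
  assert (HG : 0 < G <= exp (- x ^ 2)).
  { split.
    - apply RInt_gt_0; [lra| |].
      + intros; apply Rdiv_lt_0_compat; [apply exp_pos | nra].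
      + intros z _.
        apply (ex_derive_continuous
          (fun s => exp (- x ^ 2 * (1 + s ^ 2)) / (1 + s ^ 2))).
        auto_derive; nra.
    - replace (exp (- x ^ 2)) with (RInt (fun _ => exp (- x ^ 2)) 0 1).
      + apply RInt_le; [lra|apply ex_RInt_gaussian_param|apply ex_RInt_const|].
        intros s _. apply Rle_trans with (exp (- x ^ 2 * (1 + s ^ 2)) / 1).
        * apply Rmult_le_compat_l; [left; apply exp_pos|].
          apply Rinv_le_contravar; nra.
        * unfold Rdiv; rewrite Rinv_1, Rmult_1_r; apply exp_nondecreasing; nra.
      + rewrite RInt_const; unfold scal; simpl; unfold mult; simpl; ring. }
  rewrite E.
  assert (0 < 4 / PI) by (apply Rdiv_lt_0_compat; lra).
  split; nra.
Qed.

Lemma erf_lt_1 (x : R) : erf x < 1.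
Proof. pose proof (erf_sqr_bounds x); nra. Qed.

Lemma is_lim_erf : is_lim erf p_infty 1.
Proof.
  assert (HPI := PI_RGT_0).
  apply (is_lim_le_le_loc (fun x => 1 - 4 / PI * exp (- x)) (fun _ => 1)).
  (* For [x > 1], [erf x >= erf x ^ 2] because [erf x] lies in [(0, 1)], and [x ^ 2 >= x] replaces
     the Gaussian by a plain exponential. *)
  - exists 1; intros x Hx; pose proof (erf_sqr_bounds x); pose proof (erf_lt_1 x).
    pose proof (erf_pos x ltac:(lra)).
    assert (exp (- x ^ 2) <= exp (- x)) by (apply exp_nondecreasing; nra).
    assert (0 < 4 / PI) by (apply Rdiv_lt_0_compat; lra).
    split; nra.
  - replace (Finite 1) with (Finite (1 - 4 / PI * 0)) by (f_equal; ring).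
    apply (is_lim_minus' (fun _ => 1) (fun x => 4 / PI * exp (- x))).
    + apply is_lim_const.
    + apply (is_lim_scal_l (fun x => exp (- x)) (4 / PI) p_infty 0).
      apply (is_lim_comp exp (fun x => - x) p_infty 0 m_infty).
      * apply is_lim_exp_m.
      * apply (is_lim_opp (fun x => x) p_infty p_infty), is_lim_id.
      * now exists 0.
  - apply is_lim_const.
Qed.

(* [erf z + exp (- z ^ 2) / (z * sqrt PI)] decreases to [1] *)
Lemma erfc_lt_gaussian (z : R) : 0 < z ->
  z * erfc z < exp (- z ^ 2) / sqrt PI.
Proof.
  intros Hz; pose proof sqrt_PI_pos as HP.
  set (f := fun x => - (erf x + exp (- x ^ 2) / (x * sqrt PI))).
  assert (Hf : forall x y, 0 < x -> x < y -> f x < f y).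
  { intros x y Hx Hxy.
    apply (incr_function f 0 p_infty (fun x => exp (- x ^ 2) / (x ^ 2 * sqrt PI)));
      try easy.
    - intros u Hu _; simpl in Hu; unfold f.
      auto_derive.
      + split; [eexists; apply is_derive_erf|split; trivial; nra].
      + rewrite Derive_erf.
        simpl; field; split; lra.
    - intros u Hu _; simpl in Hu; apply Rdiv_lt_0_compat; [apply exp_pos|].
      apply Rmult_lt_0_compat; [apply pow_lt|]; lra. }
  (* As [f] increases, a value above [-1] here would keep [erf] below a constant less than [1] from
     [z + 1] on, against its limit. Arguing at [z + 1] leaves a strict inequality at [z]. *)
  assert (Hle : f (z + 1) <= -1).
  { destruct (Rle_or_lt (f (z + 1)) (-1)) as [|Hc]; trivial; exfalso.
    assert (E : Rbar_le (Finite 1) (Finite (- f (z + 1)))).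
    { apply (is_lim_le_loc erf (fun _ => - f (z + 1)) p_infty).
      - exists (z + 1); intros x Hx; pose proof (Hf (z + 1) x ltac:(lra) Hx) as Hfx.
        unfold f in Hfx at 2.
        assert (0 < exp (- x ^ 2) / (x * sqrt PI)).
        { apply Rdiv_lt_0_compat; [apply exp_pos|nra]. }
        lra.
      - apply is_lim_erf.
      - apply is_lim_const. }
    simpl in E; lra. }
  pose proof (Hf z (z + 1) Hz ltac:(lra)) as Hlt; unfold f in Hlt at 1.
  unfold erfc.
  replace (exp (- z ^ 2) / sqrt PI) with (z * (exp (- z ^ 2) / (z * sqrt PI)))
    by (field; lra).
  apply Rmult_lt_compat_l; lra.
Qed.

(** The derivative has the sign of [exp (- z ^ 2) / sqrt PI - z * erfc z], which [erfc_lt_gaussian]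
    makes positive. *)
Lemma mills_increasing (x y : R) : 0 < x < y ->
  exp (- x ^ 2) / erfc x < exp (- y ^ 2) / erfc y.
Proof.
  intros [Hx Hxy]; pose proof sqrt_PI_pos as HP.
  apply (incr_function (fun z => exp (- z ^ 2) / erfc z) 0 p_infty
    (fun z => 2 * exp (- z ^ 2) * (exp (- z ^ 2) / sqrt PI - z * erfc z)
              / erfc z ^ 2)); try easy; unfold erfc.
  - intros z Hz _; pose proof (erf_lt_1 z); auto_derive.
    + split; [eexists; apply is_derive_erf|split; trivial; lra].
    + rewrite Derive_erf.
      simpl; field; split; lra.
  - intros z Hz _; pose proof (erf_lt_1 z); pose proof (exp_pos (- z ^ 2)).
    pose proof (erfc_lt_gaussian z Hz); unfold erfc in *.
    apply Rdiv_lt_0_compat; [|apply pow_lt; lra].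
    apply Rmult_lt_0_compat; lra.
Qed.

(** * The equations for the free boundary coefficients *)

Lemma alpha1_pos (d : data) : admissible d -> 0 < alpha1 d.
Proof. intros []; now apply Rdiv_lt_0_compat; [|apply Rmult_lt_0_compat]. Qed.

Lemma alpha2_pos (d : data) : admissible d -> 0 < alpha2 d.
Proof. intros []; now apply Rdiv_lt_0_compat; [|apply Rmult_lt_0_compat]. Qed.

Lemma alpha3_pos (d : data) : admissible d -> 0 < alpha3 d.
Proof. intros []; now apply Rdiv_lt_0_compat; [|apply Rmult_lt_0_compat]. Qed.

Lemma delta1_pos (d : data) : admissible d -> 0 < delta1 d.
Proof. intros []; now apply Rmult_lt_0_compat. Qed.

Lemma delta2_pos (d : data) : admissible d -> 0 < delta2 d.
Proof. intros []; now apply Rmult_lt_0_compat. Qed.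

Lemma sqrt_ratio_pos (a b : R) : 0 < a -> 0 < b -> 0 < sqrt (a / b).
Proof. intros; now apply sqrt_lt_R0, Rdiv_lt_0_compat. Qed.

Lemma Ste1_pos (d : data) : admissible d -> 0 < Ste1 d.
Proof.
  intros []; apply Rdiv_lt_0_compat; trivial; apply Rmult_lt_0_compat; lra.
Qed.

Lemma phi_gt (d : data) (z : R) : admissible d -> z < phi d z.
Proof.
  intros Hd; unfold phi, erfc.
  pose proof (Ste1_pos d Hd); pose proof sqrt_PI_pos; pose proof (erf_lt_1 z).
  assert (0 < Ste1 d / sqrt PI * (exp (- z ^ 2) / (1 - erf z))); [|lra].
  apply Rmult_lt_0_compat; apply Rdiv_lt_0_compat; try lra; apply exp_pos.
Qed.

Lemma phi_increasing (d : data) (x y : R) :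
  admissible d -> 0 < x < y -> phi d x < phi d y.
Proof.
  intros Hd Hxy; apply Rplus_lt_compat; [lra|].
  apply Rmult_lt_compat_l; [|now apply mills_increasing].
  apply Rdiv_lt_0_compat; [now apply Ste1_pos | apply sqrt_PI_pos].
Qed.

Lemma ex_derive_phi (d : data) (z : R) : ex_derive (phi d) z.
Proof.
  unfold phi, erfc; pose proof (erf_lt_1 z); auto_derive.
  split; [eexists; apply is_derive_erf | split; trivial; lra].
Qed.

Definition H_factor (d : data) : R :=
  Ste2 d / sqrt PI * (l2 d / l1 d) * sqrt (k2 d * c1 d / (k1 d * c2 d)).

Lemma H_factor_pos (d : data) : admissible d -> 0 < H_factor d.
Proof.
  intros []; pose proof sqrt_PI_pos; unfold H_factor, Ste2.
  repeat first [assumption | apply Rdiv_lt_0_compat | apply Rmult_lt_0_compat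
               | apply sqrt_lt_R0]; lra.
Qed.

(** This ties the constant of [H] to the heat flux in the middle phase: [k2 c1 / (k1 c2)] is
    [alpha2 / alpha1], and [k2] is [rho c2 alpha2]. *)
Lemma H_factor_eq (d : data) : admissible d ->
  sqrt (alpha1 d) * delta1 d * H_factor d
  = k2 d * (tempB d - tempC d) / (sqrt (alpha2 d) * sqrt PI).
Proof.
  intros Hd; pose proof (alpha1_pos d Hd) as Ha1; pose proof (alpha2_pos d Hd) as Ha2.
  pose proof sqrt_PI_pos.
  pose proof (sqrt_lt_R0 _ Ha1); pose proof (sqrt_lt_R0 _ Ha2).
  destruct Hd.
  assert (Ek : k2 d = rho d * c2 d * (sqrt (alpha2 d) * sqrt (alpha2 d))).
  { rewrite sqrt_sqrt by lra; unfold alpha2; field; lra. }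
  unfold H_factor.
  replace (k2 d * c1 d / (k1 d * c2 d)) with (alpha2 d / alpha1 d)
    by (unfold alpha1, alpha2; field; lra).
  rewrite sqrt_div by lra.
  unfold Ste2, delta1; rewrite Ek; field; lra.
Qed.

Lemma H_eq (d : data) (z : R) :
  H d z = erf (z * sqrt (alpha1 d / alpha2 d))
          - H_factor d * (exp (- (z ^ 2 * (alpha1 d / alpha2 d))) / phi d z).
Proof. reflexivity. Qed.

(** The subtracted quotient decreases, having a decreasing numerator and the increasing denominator
    [phi]. *)
Lemma H_increasing (d : data) (x y : R) :
  admissible d -> 0 < x < y -> H d x < H d y.
Proof.
  intros Hd Hxy; rewrite 2!H_eq.
  pose proof (alpha1_pos d Hd) as Ha1; pose proof (alpha2_pos d Hd) as Ha2.
  pose proof (sqrt_ratio_pos _ _ Ha1 Ha2) as Hr.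
  pose proof (Rdiv_lt_0_compat _ _ Ha1 Ha2).
  pose proof (phi_increasing d x y Hd Hxy); pose proof (phi_gt d x Hd).
  assert (exp (- (y ^ 2 * (alpha1 d / alpha2 d))) / phi d y
          < exp (- (x ^ 2 * (alpha1 d / alpha2 d))) / phi d x).
  { apply Rmult_gt_0_lt_compat.
    - apply Rinv_0_lt_compat; lra.
    - apply exp_pos.
    - apply exp_increasing, Ropp_lt_contravar, Rmult_lt_compat_r; trivial; nra.
    - apply Rinv_lt_contravar; nra. }
  pose proof (H_factor_pos d Hd).
  pose proof (erf_increasing (x * sqrt (alpha1 d / alpha2 d))
    (y * sqrt (alpha1 d / alpha2 d)) ltac:(nra)).
  nra.
Qed.

Lemma ex_derive_H (d : data) (z : R) : admissible d -> 0 < z -> ex_derive (H d) z.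
Proof.
  intros Hd Hz; pose proof (phi_gt d z Hd).
  apply (ex_derive_ext (fun z => erf (z * sqrt (alpha1 d / alpha2 d))
          - H_factor d * (exp (- (z ^ 2 * (alpha1 d / alpha2 d))) / phi d z))).
  { intros; symmetry; apply H_eq. }
  auto_derive.
  split; [eexists; apply is_derive_erf|].
  split; [apply ex_derive_phi|]. split; trivial; lra.
Qed.

(* The second Stefan condition, multiplied by [exp (y ^ 2 * alpha1 / alpha2)]:
   up to the factor [sqrt (alpha1 d) * delta2 d] this is the sum of [Q] at [x]
   and of the subtracted term of [V] or [P] at [y]. *)
Definition interface_flux (d : data) (x y : R) : R :=
  sqrt (alpha1 d)
  * (delta2 d * y * exp (y ^ 2 * (alpha1 d / alpha2 d))
     + delta1 d * phi d x * exp (x ^ 2 * (alpha1 d / alpha2 d))).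

(* [x] and [y] are the coefficients of [y1] and [y2]; [q / sqrt t] is the flux
   entering the phase of [Phi3] at the fixed face. *)
Record interface_equations (d : data) (x y q : R) : Prop := {
  interface_order : 0 < y < x;
  interface_H : erf (y * sqrt (alpha1 d / alpha2 d)) = H d x;
  interface_stefan2 :
    q * exp (y ^ 2 * (alpha1 d / alpha2 d - alpha1 d / alpha3 d))
    = interface_flux d x y
}.

(** * Uniqueness of the coefficients *)

Lemma interface_flux_increasing (d : data) (x y x' y' : R) :
  admissible d -> 0 <= y <= y' -> 0 < x < x' ->
  0 < interface_flux d x y < interface_flux d x' y'.
Proof.
  intros Hd Hy Hx; unfold interface_flux.
  pose proof (alpha1_pos d Hd) as Ha1; pose proof (alpha2_pos d Hd) as Ha2.
  pose proof (sqrt_lt_R0 _ Ha1) as Hs.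
  pose proof (Rdiv_lt_0_compat _ _ Ha1 Ha2) as Hr.
  pose proof (delta1_pos d Hd); pose proof (delta2_pos d Hd).
  pose proof (phi_increasing d x x' Hd Hx); pose proof (phi_gt d x Hd).
  set (r := alpha1 d / alpha2 d) in *.
  assert (exp (x ^ 2 * r) <= exp (x' ^ 2 * r))
    by (apply exp_nondecreasing, Rmult_le_compat_r; nra).
  assert (exp (y ^ 2 * r) <= exp (y' ^ 2 * r))
    by (apply exp_nondecreasing, Rmult_le_compat_r; nra).
  pose proof (exp_pos (x ^ 2 * r)); pose proof (exp_pos (y ^ 2 * r)).
  assert (0 <= delta2 d * y * exp (y ^ 2 * r) <= delta2 d * y' * exp (y' ^ 2 * r)).
  { split; [apply Rmult_le_pos; nra|apply Rmult_le_compat; nra]. }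
  (* Strictness comes from [phi] in the term in [x], so [y] may stay fixed. *)
  assert (0 < delta1 d * phi d x * exp (x ^ 2 * r)
          < delta1 d * phi d x' * exp (x' ^ 2 * r)).
  { split; [apply Rmult_lt_0_compat; [apply Rmult_lt_0_compat|]; lra|].
    apply Rlt_le_trans with (delta1 d * phi d x' * exp (x ^ 2 * r)).
    - apply Rmult_lt_compat_r; nra.
    - apply Rmult_le_compat_l; nra. }
  split; [apply Rmult_lt_0_compat|apply Rmult_lt_compat_l]; lra.
Qed.

(* [y] increases with [x] by the first equation, so that the left-hand side of
   the second one decreases and its right-hand side increases. *)
Lemma interface_equations_le (d : data) (x y q x' y' q' : R) :
  admissible d -> interface_equations d x y q -> interface_equations d x' y' q' ->
  (y < y' -> q' <= q) -> x' <= x.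
Proof.
  intros Hd [Hxy EH Es] [Hxy' EH' Es'] Hq.
  destruct (Rle_or_lt x' x) as [|Hx]; trivial; exfalso.
  pose proof (alpha1_pos d Hd) as Ha1; pose proof (alpha2_pos d Hd) as Ha2.
  pose proof (alpha3_pos d Hd) as Ha3.
  pose proof (sqrt_ratio_pos _ _ Ha1 Ha2) as Hr.
  pose proof (H_increasing d x x' Hd ltac:(lra)) as HH.
  rewrite <- EH, <- EH' in HH.
  apply erf_lt_inv, Rmult_lt_reg_r in HH; trivial.
  specialize (Hq HH).
  destruct (interface_flux_increasing d x y x' y' Hd ltac:(lra) ltac:(lra)) as [Hf0 Hf].
  rewrite <- Es in Hf, Hf0; rewrite <- Es' in Hf.
  set (s := alpha1 d / alpha2 d - alpha1 d / alpha3 d) in *.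
  (* Here [alpha3 < alpha2] enters: the exponential on the left-hand side does not grow with [y]. *)
  assert (Hs : s <= 0).
  { pose proof (alpha3_lt_alpha2 d Hd) as Ha.
    pose proof (Rinv_lt_contravar _ _ (Rmult_lt_0_compat _ _ Ha3 Ha2) Ha).
    unfold s, Rdiv; nra. }
  assert (exp (y' ^ 2 * s) <= exp (y ^ 2 * s)).
  { apply exp_nondecreasing; assert (y ^ 2 <= y' ^ 2) by nra; nra. }
  pose proof (exp_pos (y' ^ 2 * s)); pose proof (exp_pos (y ^ 2 * s)).
  (* Now [q'] times its exponential is at most [q] times its own, although the flux has strictly
     grown. *)
  assert (0 < q) by nra. nra.
Qed.

(** The comparison in both directions gives [x = x'], and injectivity of [erf] then gives [y = y'].
    The conditions on [q] say that it does not grow with [y], which covers both a prescribed flux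
    and a prescribed temperature. *)
Lemma interface_equations_unique (d : data) (x y q x' y' q' : R) :
  admissible d -> interface_equations d x y q -> interface_equations d x' y' q' ->
  (y < y' -> q' <= q) -> (y' < y -> q <= q') -> x = x' /\ y = y'.
Proof.
  intros Hd E E' Hq Hq'.
  assert (Ex : x = x').
  { apply Rle_antisym; eapply interface_equations_le; eauto. }
  subst x'; split; trivial.
  apply (Rmult_eq_reg_r (sqrt (alpha1 d / alpha2 d))).
  - apply erf_inj; rewrite (interface_H _ _ _ _ E), (interface_H _ _ _ _ E').
    reflexivity.
  - apply Rgt_not_eq, sqrt_ratio_pos; [now apply alpha1_pos|now apply alpha2_pos].
Qed.

(** * Existence of the coefficients *)

Lemma interface_flux_at_z0 (d : data) (z0 : R) :
  admissible d -> 0 < z0 -> H d z0 = 0 -> interface_flux d z0 0 = q2 d z0.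
Proof.
  intros Hd Hz0 EH; rewrite H_eq in EH; unfold interface_flux, q2.
  pose proof (phi_gt d z0 Hd); pose proof (H_factor_pos d Hd).
  pose proof (alpha1_pos d Hd) as Ha1; pose proof (alpha2_pos d Hd) as Ha2.
  pose proof (sqrt_ratio_pos _ _ Ha1 Ha2) as Hr.
  pose proof (erf_pos (z0 * sqrt (alpha1 d / alpha2 d)) ltac:(nra)).
  rewrite sqrt_mult by (try apply Rlt_le, PI_RGT_0; lra).
  pose proof sqrt_PI_pos; pose proof (sqrt_lt_R0 _ Ha2).
  set (r := alpha1 d / alpha2 d) in *.
  (* This is [H d z0 = 0] cleared of denominators; it describes the limiting state whose inner
     boundary rests at the fixed face. *)
  assert (E : erf (z0 * sqrt r) * (phi d z0 * exp (z0 ^ 2 * r)) = H_factor d).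
  { replace (erf (z0 * sqrt r))
      with (H_factor d * (exp (- (z0 ^ 2 * r)) / phi d z0)) by lra.
    rewrite exp_Ropp; field; split; [apply Rgt_not_eq, exp_pos|lra]. }
  replace (k2 d * (tempB d - tempC d) / (sqrt (alpha2 d) * sqrt PI * erf (z0 * sqrt r)))
    with (k2 d * (tempB d - tempC d) / (sqrt (alpha2 d) * sqrt PI)
          / erf (z0 * sqrt r)) by (field; lra).
  rewrite <- (H_factor_eq d Hd), <- E; field; lra.
Qed.

Lemma continuous_Rmax_l (a x : R) : continuous (fun z => Rmax z a) x.
Proof.
  apply filterlim_locally; intros eps; exists eps; intros u Hu.
  change (Rabs (u - x) < eps) in Hu; change (Rabs (Rmax u a - Rmax x a) < eps).
  revert Hu; unfold Rmax, Rabs; repeat destruct Rle_dec; repeat destruct Rcase_abs; lra.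
Qed.

(* The inverse of [erf] applied to [H], extended to the left of [z0] by a
   constant so that it is continuous on the whole line. *)
Lemma inner_interface (d : data) (z0 : R) :
  admissible d -> 0 < z0 -> H d z0 = 0 ->
  exists g : R -> R,
    (forall x, continuous g x) /\
    (forall x, 0 <= g x < Rmax x z0) /\
    (forall x, erf (g x * sqrt (alpha1 d / alpha2 d)) = H d (Rmax x z0)).
Proof.
  intros Hd Hz0 EH.
  pose proof (alpha1_pos d Hd) as Ha1; pose proof (alpha2_pos d Hd) as Ha2.
  pose proof (sqrt_ratio_pos _ _ Ha1 Ha2) as Hr.
  set (r := sqrt (alpha1 d / alpha2 d)) in *.
  assert (Hm : forall x, z0 <= Rmax x z0) by (intros; apply Rmax_r).
  assert (Hlt : forall x, H d (Rmax x z0) < erf (Rmax x z0 * r)).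
  { intros x; rewrite H_eq; fold r.
    pose proof (phi_gt d (Rmax x z0) Hd); specialize (Hm x).
    assert (0 < H_factor d * (exp (- (Rmax x z0 ^ 2 * (alpha1 d / alpha2 d)))
                              / phi d (Rmax x z0))); [|lra].
    apply Rmult_lt_0_compat; [now apply H_factor_pos|].
    apply Rdiv_lt_0_compat; [apply exp_pos|lra]. }
  assert (Hge : forall x, 0 <= H d (Rmax x z0)).
  { intros x; destruct (Hm x) as [Hx|Hx]; [|rewrite <- Hx; lra].
    pose proof (H_increasing d _ _ Hd (conj Hz0 Hx)); lra. }
  (* The value of [H] lies between [erf 0] and [erf (Rmax x z0 * r)], so [erf] attains it. The sigma
     type lets the preimage define a function. *)
  assert (G : forall x, {y | 0 <= y <= Rmax x z0 /\ erf (y * r) - H d (Rmax x z0) = 0}).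
  { intros x; apply (IVT_cor (fun y => erf (y * r) - H d (Rmax x z0))).
    - intros y; apply continuity_pt_filterlim.
      apply (ex_derive_continuous (fun y => erf (y * r) - H d (Rmax x z0))).
      auto_derive; eexists; apply is_derive_erf.
    - specialize (Hm x); lra.
    - rewrite Rmult_0_l, erf_0; specialize (Hge x); specialize (Hlt x); nra. }
  exists (fun x => proj1_sig (G x)).
  assert (E : forall x, erf (proj1_sig (G x) * r) = H d (Rmax x z0)).
  { intros x; destruct (G x); simpl; lra. }
  split; [|split]; trivial.
  - intros x; apply filterlim_locally; intros eps.
    set (y := proj1_sig (G x)).
    assert (HR : continuous (fun x => H d (Rmax x z0)) x).
    { apply (continuous_comp (fun x => Rmax x z0) (H d)).
      - apply continuous_Rmax_l.
      - apply (ex_derive_continuous (H d)), ex_derive_H; trivial.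
        specialize (Hm x); lra. }
    pose proof (cond_pos eps) as Heps.
    (* Continuity of the inverse: the value of [H] at [x] lies strictly between those of [erf] for
       [y - eps] and [y + eps]. This persists near [x] and is pulled back by monotonicity of
       [erf]. *)
    assert (L : locally (H d (Rmax x z0))
      (fun v => erf ((y - eps) * r) < v /\ v < erf ((y + eps) * r))).
    { apply (open_and _ _ (open_gt _) (open_lt _)).
      rewrite <- E; fold y; split; apply erf_increasing; nra. }
    generalize (HR _ L); unfold filtermap; apply filter_imp; intros u [Hu1 Hu2].
    rewrite <- E in Hu1, Hu2.
    apply erf_lt_inv, Rmult_lt_reg_r in Hu1; trivial.
    apply erf_lt_inv, Rmult_lt_reg_r in Hu2; trivial.
    apply Rabs_def1; unfold minus, plus, opp; simpl; lra.
  - intros x; split.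
    + destruct (G x); simpl; lra.
    + apply (Rmult_lt_reg_r r); trivial; apply erf_lt_inv; rewrite E; apply Hlt.
Qed.

(* [w y * q = kappa] relates the flux coefficient [q] to the datum of the
   fixed face: [w = 1] for a given flux, [w y = erf (y * sqrt (alpha1 / alpha3))]
   for a given temperature. *)
Lemma interface_equations_exist (d : data) (z0 : R) (w : R -> R) (kappa : R) :
  admissible d -> 0 < z0 -> H d z0 = 0 ->
  (forall y, continuous w y) -> (forall y, 0 < y -> 0 < w y) ->
  (forall y y', 0 <= y <= y' -> w y <= w y') ->
  w 0 * q2 d z0 < kappa ->
  exists x y, interface_equations d x y (kappa / w y).
Proof.
  intros Hd Hz0 EH Hwc Hwp Hwi Hk.
  destruct (inner_interface d z0 Hd Hz0 EH) as [g [Hgc [Hgr Hge]]].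
  pose proof (alpha1_pos d Hd) as Ha1; pose proof (alpha2_pos d Hd) as Ha2.
  pose proof (alpha3_pos d Hd) as Ha3; pose proof (sqrt_lt_R0 _ Ha1) as Hs1.
  pose proof (sqrt_ratio_pos _ _ Ha1 Ha2) as Hr.
  pose proof (Rdiv_lt_0_compat _ _ Ha1 Ha2) as Hr2.
  pose proof (delta1_pos d Hd) as Hd1; pose proof (delta2_pos d Hd) as Hd2.
  set (s := alpha1 d / alpha2 d - alpha1 d / alpha3 d) in *.
  assert (Hs : s <= 0).
  { pose proof (alpha3_lt_alpha2 d Hd) as Ha.
    pose proof (Rinv_lt_contravar _ _ (Rmult_lt_0_compat _ _ Ha3 Ha2) Ha).
    unfold s, Rdiv; nra. }
  (* A zero of [F] solves the second interface equation, multiplied by [w] because [w 0] may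
     vanish. *)
  set (F := fun x => w (g x) * interface_flux d (Rmax x z0) (g x)
                     - kappa * exp (g x ^ 2 * s)).
  assert (Hg0 : forall x, x <= z0 -> g x = 0).
  { intros x Hx; specialize (Hge x); rewrite Rmax_right, EH, <- erf_0 in Hge by lra.
    apply erf_inj in Hge; nra. }
  assert (Hgi : forall x x', z0 <= x < x' -> g x < g x').
  { intros x x' Hx; apply (Rmult_lt_reg_r (sqrt (alpha1 d / alpha2 d))); trivial.
    apply erf_lt_inv; rewrite 2!Hge, 2!Rmax_left by lra.
    apply H_increasing; trivial; lra. }
  assert (HFc : continuity F).
  { intros x; apply continuity_pt_filterlim.
    assert (Hmax : continuous (fun x => Rmax x z0) x) by apply continuous_Rmax_l.
    apply (continuous_minus (fun x => w (g x) * interface_flux d (Rmax x z0) (g x))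
      (fun x => kappa * exp (g x ^ 2 * s))).
    - apply (continuous_mult (fun x => w (g x))).
      + now apply continuous_comp.
      + unfold interface_flux.
        apply (continuous_scal_r (sqrt (alpha1 d))
          (fun x => delta2 d * g x * exp (g x ^ 2 * (alpha1 d / alpha2 d))
            + delta1 d * phi d (Rmax x z0)
              * exp (Rmax x z0 ^ 2 * (alpha1 d / alpha2 d)))).
        apply (continuous_plus
          (fun x => delta2 d * g x * exp (g x ^ 2 * (alpha1 d / alpha2 d)))).
        * apply (continuous_comp g
            (fun y => delta2 d * y * exp (y ^ 2 * (alpha1 d / alpha2 d)))); trivial.
          apply (ex_derive_continuous
            (fun y => delta2 d * y * exp (y ^ 2 * (alpha1 d / alpha2 d)))).
          auto_derive; trivial.
        * apply (continuous_comp (fun x => Rmax x z0)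
            (fun y => delta1 d * phi d y * exp (y ^ 2 * (alpha1 d / alpha2 d))));
            trivial.
          apply (ex_derive_continuous
            (fun y => delta1 d * phi d y * exp (y ^ 2 * (alpha1 d / alpha2 d)))).
          auto_derive; apply ex_derive_phi.
    - apply (continuous_comp g (fun y => kappa * exp (y ^ 2 * s))); trivial.
      apply (ex_derive_continuous (fun y => kappa * exp (y ^ 2 * s))).
      auto_derive; trivial. }
  (* At [z0] the inner coefficient is [0] and the flux is [q2 d z0], so this is the threshold
     hypothesis. *)
  assert (HF0 : F z0 < 0).
  { unfold F; rewrite (Hg0 z0), Rmax_left, interface_flux_at_z0 by lra || trivial.
    replace (0 ^ 2 * s) with 0 by ring; rewrite exp_0; lra. }
  set (W := w (g (z0 + 1))).
  assert (HW : 0 < W).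
  { apply Hwp; rewrite <- (Hg0 z0) by lra; apply Hgi; lra. }
  (* From [z0 + 1] on, [w (g x)] is at least [W > 0] and the flux exceeds
     [sqrt (alpha1 d) * delta1 d * x]; [X] is large enough for the product to exceed
     [Rabs kappa]. *)
  set (X := z0 + 1 + Rabs kappa / (W * sqrt (alpha1 d) * delta1 d)).
  assert (Hc : 0 < W * sqrt (alpha1 d) * delta1 d)
    by (apply Rmult_lt_0_compat; [apply Rmult_lt_0_compat|]; lra).
  assert (HX : z0 + 1 <= X).
  { unfold X; pose proof (Rabs_pos kappa).
    assert (0 <= Rabs kappa / (W * sqrt (alpha1 d) * delta1 d)); [|lra].
    apply Rmult_le_pos; trivial; left; now apply Rinv_0_lt_compat. }
  assert (HFX : 0 < F X).
  { assert (HgX : g (z0 + 1) <= g X).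
    { destruct HX as [HX| <-]; [left; apply Hgi; lra|lra]. }
    pose proof (Hgr (z0 + 1)) as Hg1.
    assert (HWX : W <= w (g X)) by (apply Hwi; lra).
    assert (Hfl : sqrt (alpha1 d) * delta1 d * X < interface_flux d (Rmax X z0) (g X)).
    { rewrite Rmax_left by lra; unfold interface_flux.
      rewrite Rmult_assoc; apply Rmult_lt_compat_l; trivial.
      assert (1 <= exp (X ^ 2 * (alpha1 d / alpha2 d)))
        by (rewrite <- exp_0; apply exp_nondecreasing, Rmult_le_pos; nra).
      pose proof (phi_gt d X Hd).
      assert (0 <= delta2 d * g X * exp (g X ^ 2 * (alpha1 d / alpha2 d))).
      { apply Rmult_le_pos; [nra|left; apply exp_pos]. }
      assert (delta1 d * X < delta1 d * phi d X) by (apply Rmult_lt_compat_l; lra).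
      assert (0 < delta1 d * phi d X) by nra.
      nra. }
    assert (HkX : Rabs kappa < W * (sqrt (alpha1 d) * delta1 d * X)).
    { replace (Rabs kappa) with (W * sqrt (alpha1 d) * delta1 d
        * (Rabs kappa / (W * sqrt (alpha1 d) * delta1 d))) by (field; lra).
      replace (W * (sqrt (alpha1 d) * delta1 d * X))
        with (W * sqrt (alpha1 d) * delta1 d * X) by ring.
      apply Rmult_lt_compat_l; trivial; unfold X; lra. }
    assert (exp (g X ^ 2 * s) <= 1)
      by (rewrite <- exp_0; apply exp_nondecreasing; nra).
    pose proof (exp_pos (g X ^ 2 * s)).
    assert (kappa * exp (g X ^ 2 * s) <= Rabs kappa).
    { pose proof (Rle_abs kappa); pose proof (Rabs_pos kappa); nra. }
    assert (0 < sqrt (alpha1 d) * delta1 d * X).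
    { apply Rmult_lt_0_compat; [apply Rmult_lt_0_compat|]; lra. }
    assert (W * (sqrt (alpha1 d) * delta1 d * X)
            <= w (g X) * interface_flux d (Rmax X z0) (g X))
      by (apply Rmult_le_compat; lra).
    unfold F; lra. }
  destruct (IVT F z0 X HFc ltac:(lra) HF0 HFX) as [x [[Hx _] Ex]].
  (* The zero differs from [z0], so that [g x > 0] and dividing by [w (g x)] is legitimate. *)
  assert (Hx' : z0 < x).
  { destruct Hx as [|Hx]; trivial; rewrite Hx in HF0; lra. }
  assert (Hgx : 0 < g x).
  { rewrite <- (Hg0 z0) by lra; apply Hgi; lra. }
  specialize (Hgr x); specialize (Hge x); unfold F in Ex.
  rewrite Rmax_left in Hgr, Hge, Ex by lra.
  pose proof (Hwp _ Hgx) as Hwx.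
  exists x, (g x); split; [lra|trivial|].
  fold s; apply (Rmult_eq_reg_l (w (g x))); [|lra].
  replace (w (g x) * (kappa / w (g x) * exp (g x ^ 2 * s)))
    with (kappa * exp (g x ^ 2 * s)) by (field; lra).
  lra.
Qed.

(** * Similarity profiles *)

Definition profile (alpha a b x t : R) : R :=
  a + b * erf (x / (2 * sqrt (alpha * t))).

(** Twice the fundamental solution of the heat equation, normalised as the space derivative of
    [erf (x / (2 * sqrt (alpha * t)))]. *)
Definition heat_kernel (alpha x t : R) : R :=
  exp (- (x / (2 * sqrt (alpha * t))) ^ 2) / (sqrt PI * sqrt (alpha * t)).

Lemma is_derive_profile_space (alpha a b x t : R) : 0 < alpha * t ->
  is_derive (fun z => profile alpha a b z t) x (b * heat_kernel alpha x t).
Proof.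
  intros Ht; pose proof (sqrt_lt_R0 _ Ht) as Hs; pose proof sqrt_PI_pos.
  unfold profile, heat_kernel; auto_derive.
  - eexists; apply is_derive_erf.
  - rewrite Derive_erf; unfold Rdiv; field; lra.
Qed.

Lemma is_derive_heat_kernel_space (alpha x t : R) : 0 < alpha * t ->
  is_derive (fun z => heat_kernel alpha z t) x
    (heat_kernel alpha x t * (- x / (2 * (alpha * t)))).
Proof.
  intros Ht; pose proof (sqrt_lt_R0 _ Ht) as Hs; pose proof sqrt_PI_pos.
  rewrite <- (sqrt_sqrt (alpha * t)) by lra.
  unfold heat_kernel; auto_derive; [trivial|].
  simpl; unfold Rdiv; field; lra.
Qed.

Lemma is_derive_profile_time (alpha a b x t : R) : 0 < alpha -> 0 < t ->
  is_derive (fun s => profile alpha a b x s) t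
    (b * heat_kernel alpha x t * (- x / (2 * t))).
Proof.
  intros Ha Ht; pose proof (Rmult_lt_0_compat _ _ Ha Ht) as Hat.
  pose proof (sqrt_lt_R0 _ Hat) as Hs; pose proof sqrt_PI_pos.
  unfold profile, heat_kernel; auto_derive.
  - split; [eexists; apply is_derive_erf|]; repeat split; lra.
  - rewrite Derive_erf.
    assert (E : alpha = sqrt (alpha * t) * sqrt (alpha * t) / t)
      by (rewrite sqrt_sqrt by lra; field; lra).
    set (u := sqrt (alpha * t)) in *; unfold Rdiv; rewrite E at 1; field; lra.
Qed.

(** The time derivative and the second space derivative are both multiples of the heat kernel, with
    factors [- x / (2 * t)] and [- x / (2 * (alpha * t))]. *)
Lemma heat_equation_profile (alpha a b : R) (region : R -> R -> Prop) :
  0 < alpha -> heat_equation alpha (profile alpha a b) region.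
Proof.
  intros Ha x t Ht _; pose proof (Rmult_lt_0_compat _ _ Ha Ht) as Hat.
  assert (E2 : is_derive (Derive (fun z => profile alpha a b z t)) x
    (b * (heat_kernel alpha x t * (- x / (2 * (alpha * t)))))).
  { apply (is_derive_ext (fun z => b * heat_kernel alpha z t)).
    - intros z; symmetry; apply is_derive_unique; now apply is_derive_profile_space.
    - exact (is_derive_scal _ x b _ (is_derive_heat_kernel_space alpha x t Hat)). }
  split; [|split; [|split]].
  - eexists; now apply is_derive_profile_time.
  - eexists; now apply is_derive_profile_space.
  - eexists; exact E2.
  - etransitivity; [apply is_derive_unique; now apply is_derive_profile_time|].
    transitivity (alpha * (b * (heat_kernel alpha x t * (- x / (2 * (alpha * t)))))).
    + field; lra.
    + f_equal; symmetry; exact (is_derive_unique _ _ _ E2).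
Qed.

Lemma filterlim_erf_div (alpha x : R) : 0 < alpha -> 0 < x ->
  filterlim (fun t => erf (x / (2 * sqrt (alpha * t)))) (at_right 0) (locally 1).
Proof.
  intros Ha Hx.
  apply (filterlim_comp _ _ _ (fun t => x / (2 * sqrt (alpha * t))) erf
    _ (Rbar_locally p_infty)); [|exact is_lim_erf].
  intros P [M HM].
  (* A positive bound in place of [M]; the radius below is where [sqrt (alpha * t)] reaches
     [x / (2 * N)]. *)
  set (N := Rmax M 1).
  assert (HN : 0 < N) by (pose proof (Rmax_r M 1); unfold N; lra).
  assert (Hd : 0 < (x / (2 * N)) ^ 2 / alpha).
  { apply Rdiv_lt_0_compat; trivial; apply pow_lt, Rdiv_lt_0_compat; lra. }
  exists (mkposreal _ Hd); intros t Ht Ht0; apply HM.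
  change (Rabs (t - 0) < (x / (2 * N)) ^ 2 / alpha) in Ht.
  rewrite Rminus_0_r, Rabs_right in Ht by lra.
  apply Rle_lt_trans with N; [apply Rmax_l|].
  pose proof (Rmult_lt_0_compat _ _ Ha Ht0) as Hat.
  pose proof (sqrt_lt_R0 _ Hat) as Hs.
  assert (Hl : sqrt (alpha * t) < x / (2 * N)).
  { rewrite <- (sqrt_pow2 (x / (2 * N))) by (left; apply Rdiv_lt_0_compat; lra).
    apply sqrt_lt_1; [lra|apply pow2_ge_0|].
    apply Rmult_lt_compat_l with (r := alpha) in Ht; trivial.
    replace (alpha * ((x / (2 * N)) ^ 2 / alpha)) with ((x / (2 * N)) ^ 2) in Ht
      by (field; lra). lra. }
  apply (Rmult_lt_reg_r (2 * sqrt (alpha * t))); [lra|].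
  replace (x / (2 * sqrt (alpha * t)) * (2 * sqrt (alpha * t))) with x by (field; lra).
  apply Rmult_lt_compat_l with (r := 2 * N) in Hl; [|lra].
  replace (2 * N * (x / (2 * N))) with x in Hl by (field; lra). lra.
Qed.

Lemma is_lim_profile (alpha a b t : R) : 0 < alpha * t ->
  is_lim (fun x => profile alpha a b x t) p_infty (a + b).
Proof.
  intros Ht; pose proof (sqrt_lt_R0 _ Ht) as Hs; unfold profile.
  apply (is_lim_plus' (fun _ => a)); [apply is_lim_const|].
  replace (Finite b) with (Rbar_mult b 1) by (simpl; f_equal; ring).
  apply is_lim_scal_l.
  apply (is_lim_comp erf (fun x => x / (2 * sqrt (alpha * t))) p_infty 1 p_infty).
  - exact is_lim_erf.
  - intros P [M HM]; exists (M * (2 * sqrt (alpha * t))); intros x Hx; apply HM.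
    apply (Rmult_lt_reg_r (2 * sqrt (alpha * t))); [lra|].
    replace (x / (2 * sqrt (alpha * t)) * (2 * sqrt (alpha * t))) with x
      by (field; lra). lra.
  - now exists 0.
Qed.

Lemma filterlim_profile_initial (alpha a b x : R) : 0 < alpha -> 0 < x ->
  filterlim (fun t => profile alpha a b x t) (at_right 0) (locally (a + b)).
Proof.
  intros Ha Hx; unfold profile.
  replace (a + b) with (a + b * 1) by ring.
  apply (filterlim_comp _ _ _ (fun t => erf (x / (2 * sqrt (alpha * t))))
    (fun v => a + b * v) _ (locally 1)).
  - now apply filterlim_erf_div.
  - apply (ex_derive_continuous (fun v => a + b * v)); auto_derive; trivial.
Qed.

(** * One-sided derivatives and the Stefan conditions *)

Lemma is_derive_quotient (f : R -> R) (a l : R) : is_derive f a l ->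
  filterlim (fun x => (f x - f a) / (x - a)) (locally' a) (locally l).
Proof.
  intros Hf; apply is_derive_Reals in Hf; apply filterlim_locally; intros eps.
  destruct (Hf eps (cond_pos eps)) as [del Hdel].
  exists del; intros x Hx Hxa.
  specialize (Hdel (x - a) (Rminus_eq_contra _ _ Hxa) Hx).
  now rewrite Rplus_minus in Hdel.
Qed.

(** A one-sided limit sees only the values of [g] inside its phase, where [g] is the smooth profile
    [f]; the converse is uniqueness of limits. *)
Lemma is_right_derive_iff (f g : R -> R) (a b l l' : R) : a < b ->
  (forall x, a <= x < b -> f x = g x) -> is_derive f a l ->
  is_right_derive g a l' <-> l' = l.
Proof.
  intros Hab Hfg Hf.
  assert (Hg : is_right_derive g a l).
  { apply (filterlim_ext_loc (fun x => (f x - f a) / (x - a))).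
    - exists (mkposreal (b - a) ltac:(lra)); intros x Hx Hxa.
      apply Rabs_lt_between in Hx; unfold minus, plus, opp in Hx; simpl in Hx.
      rewrite 2!Hfg by lra; reflexivity.
    - eapply filterlim_filter_le_1; [|now apply is_derive_quotient].
      intros P [eps HP]; exists eps; intros x Hx Hxa; apply HP; trivial.
      now apply Rgt_not_eq. }
  split; intros E; [|now rewrite E].
  exact (filterlim_locally_unique _ _ _ E Hg).
Qed.

Lemma is_left_derive_iff (f g : R -> R) (a b l l' : R) : b < a ->
  (forall x, b < x <= a -> f x = g x) -> is_derive f a l ->
  is_left_derive g a l' <-> l' = l.
Proof.
  intros Hab Hfg Hf.
  assert (Hg : is_left_derive g a l).
  { apply (filterlim_ext_loc (fun x => (f x - f a) / (x - a))).
    - exists (mkposreal (a - b) ltac:(lra)); intros x Hx Hxa.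
      apply Rabs_lt_between in Hx; unfold minus, plus, opp in Hx; simpl in Hx.
      rewrite 2!Hfg by lra; reflexivity.
    - eapply filterlim_filter_le_1; [|now apply is_derive_quotient].
      intros P [eps HP]; exists eps; intros x Hx Hxa; apply HP; trivial.
      now apply Rlt_not_eq. }
  split; intros E; [|now rewrite E].
  exact (filterlim_locally_unique _ _ _ E Hg).
Qed.

Definition free_boundary (d : data) (eta t : R) : R := 2 * eta * sqrt (alpha1 d * t).

Lemma is_derive_free_boundary (d : data) (eta t : R) : 0 < alpha1 d -> 0 < t ->
  is_derive (free_boundary d eta) t (eta * sqrt (alpha1 d) / sqrt t).
Proof.
  intros Ha Ht; pose proof (Rmult_lt_0_compat _ _ Ha Ht).
  unfold free_boundary; auto_derive; trivial.
  rewrite sqrt_mult by lra.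
  pose proof (sqrt_lt_R0 _ Ha); pose proof (sqrt_lt_R0 _ Ht).
  rewrite <- (sqrt_sqrt (alpha1 d)) at 1 by lra; field; lra.
Qed.

Lemma free_boundary_rescaled (d : data) (eta alpha t : R) :
  0 < alpha1 d -> 0 < alpha -> 0 < t ->
  free_boundary d eta t / (2 * sqrt (alpha * t)) = eta * sqrt (alpha1 d / alpha).
Proof.
  intros Ha1 Ha Ht; unfold free_boundary.
  rewrite sqrt_div, 2!sqrt_mult by lra.
  pose proof (sqrt_lt_R0 _ Ha); pose proof (sqrt_lt_R0 _ Ht); field; lra.
Qed.

Lemma heat_kernel_free_boundary (d : data) (eta alpha t : R) :
  0 < alpha1 d -> 0 < alpha -> 0 < t ->
  heat_kernel alpha (free_boundary d eta t) t
  = exp (- (eta ^ 2 * (alpha1 d / alpha))) / (sqrt PI * sqrt alpha * sqrt t).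
Proof.
  intros Ha1 Ha Ht; unfold heat_kernel.
  rewrite free_boundary_rescaled, sqrt_mult by lra.
  replace ((eta * sqrt (alpha1 d / alpha)) ^ 2) with (eta ^ 2 * (alpha1 d / alpha)).
  - f_equal; ring.
  - rewrite Rpow_mult_distr, pow2_sqrt; [ring|].
    apply Rlt_le, Rdiv_lt_0_compat; lra.
Qed.

Lemma free_boundary_increasing (d : data) (eta eta' t : R) :
  0 < alpha1 d -> 0 < t -> eta < eta' -> free_boundary d eta t < free_boundary d eta' t.
Proof.
  intros Ha Ht He; unfold free_boundary.
  apply Rmult_lt_compat_r; [|lra]; apply sqrt_lt_R0, Rmult_lt_0_compat; lra.
Qed.

Lemma free_boundary_pos (d : data) (eta t : R) :
  0 < alpha1 d -> 0 < t -> 0 < eta -> 0 < free_boundary d eta t.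
Proof.
  intros Ha Ht He; replace 0 with (free_boundary d 0 t) by (unfold free_boundary; ring).
  now apply free_boundary_increasing.
Qed.

(* All three terms of the Stefan condition are multiples of [1 / sqrt t]. *)
Lemma stefan_condition_iff (d : data) (kr kl delta alphar alphal ar br al bl eta : R)
    (Phir Phil : R -> R -> R) (y lo hi : R -> R) :
  0 < alpha1 d -> 0 < alphar -> 0 < alphal ->
  (forall t, 0 <= t -> free_boundary d eta t = y t) ->
  (forall t, 0 < t -> lo t < y t < hi t) ->
  (forall x t, 0 < t -> y t <= x < hi t -> profile alphar ar br x t = Phir x t) ->
  (forall x t, 0 < t -> lo t < x <= y t -> profile alphal al bl x t = Phil x t) ->
  stefan_condition kr kl delta Phir Phil y <->
  kr * br * exp (- (eta ^ 2 * (alpha1 d / alphar))) / sqrt alphar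
  - kl * bl * exp (- (eta ^ 2 * (alpha1 d / alphal))) / sqrt alphal
  = sqrt PI * delta * sqrt (alpha1 d) * eta.
Proof.
  intros Ha1 Har Hal Hy Hlh Hr Hl; pose proof sqrt_PI_pos as HP.
  pose proof (sqrt_lt_R0 _ Har); pose proof (sqrt_lt_R0 _ Hal).
  (* The square-root law for [y] is given for nonnegative times only, which still covers a
     neighbourhood of each [t > 0]. *)
  assert (Dy : forall t, 0 < t -> is_derive y t (eta * sqrt (alpha1 d) / sqrt t)).
  { intros t Ht; apply (is_derive_ext_loc (free_boundary d eta)).
    - exists (mkposreal t Ht); intros u Hu; apply Hy.
      apply Rabs_lt_between in Hu; unfold minus, plus, opp in Hu; simpl in Hu; lra.
    - now apply is_derive_free_boundary. }
  assert (Dr : forall t p, 0 < t -> is_right_derive (fun x => Phir x t) (y t) p <->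
    p = br * exp (- (eta ^ 2 * (alpha1 d / alphar))) / (sqrt PI * sqrt alphar * sqrt t)).
  { intros t p Ht.
    apply (is_right_derive_iff (fun x => profile alphar ar br x t) _ _ (hi t)).
    - now apply Hlh.
    - intros; now apply Hr.
    - rewrite <- Hy by lra; unfold Rdiv at 1; rewrite Rmult_assoc; fold (Rdiv
        (exp (- (eta ^ 2 * (alpha1 d / alphar)))) (sqrt PI * sqrt alphar * sqrt t)).
      rewrite <- heat_kernel_free_boundary by trivial.
      apply is_derive_profile_space, Rmult_lt_0_compat; trivial. }
  assert (Dl : forall t p, 0 < t -> is_left_derive (fun x => Phil x t) (y t) p <->
    p = bl * exp (- (eta ^ 2 * (alpha1 d / alphal))) / (sqrt PI * sqrt alphal * sqrt t)).
  { intros t p Ht.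
    apply (is_left_derive_iff (fun x => profile alphal al bl x t) _ _ (lo t)).
    - now apply Hlh.
    - intros; now apply Hl.
    - rewrite <- Hy by lra; unfold Rdiv at 1; rewrite Rmult_assoc; fold (Rdiv
        (exp (- (eta ^ 2 * (alpha1 d / alphal)))) (sqrt PI * sqrt alphal * sqrt t)).
      rewrite <- heat_kernel_free_boundary by trivial.
      apply is_derive_profile_space, Rmult_lt_0_compat; trivial. }
  split.
  (* By the common scaling the condition at [t = 1] already yields the algebraic equation. *)
  - intros Hs; destruct (Hs 1 Rlt_0_1) as [pr [pl [v [Hpr [Hpl [Hv E]]]]]].
    apply Dr in Hpr; [|lra]; apply Dl in Hpl; [|lra].
    assert (Ev : v = eta * sqrt (alpha1 d) / sqrt 1).
    { apply is_derive_unique in Hv; rewrite <- Hv.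
      apply is_derive_unique, Dy; lra. }
    rewrite sqrt_1 in Hpr, Hpl, Ev; rewrite Hpr, Hpl, Ev in E.
    apply (Rmult_eq_reg_r (/ sqrt PI)); [|apply Rinv_neq_0_compat; lra].
    etransitivity; [|etransitivity; [exact E|]]; field; lra.
  - intros E t Ht; pose proof (sqrt_lt_R0 _ Ht).
    do 3 eexists; split; [apply Dr; trivial|split; [apply Dl; trivial|split]].
    + now apply Dy.
    + apply (Rmult_eq_reg_r (sqrt PI * sqrt t)).
      * etransitivity; [|etransitivity; [exact E|]]; field; lra.
      * apply Rgt_not_eq, Rmult_lt_0_compat; lra.
Qed.

(** * Elimination of the profile constants *)

(* [Phi_i] is [ai + bi * erf (x / (2 * sqrt (alpha_i * t)))]. *)
Record similarity : Type := Similarity {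
  eta1 : R; eta2 : R;
  a1 : R; b1 : R; a2 : R; b2 : R; a3 : R; b3 : R
}.

Definition similarity_candidate (d : data) (p : similarity) : candidate :=
  Candidate (profile (alpha1 d) (a1 p) (b1 p)) (profile (alpha2 d) (a2 p) (b2 p))
    (profile (alpha3 d) (a3 p) (b3 p))
    (free_boundary d (eta1 p)) (free_boundary d (eta2 p)).

(** A candidate matters only on its phases, so one of similarity type may be compared with the
    candidate that its eight coefficients define everywhere. *)
Lemma similarity_type_coincide (d : data) (x y : R) (s : candidate) :
  similarity_type d x y s ->
  0 < y < x /\
  exists p, eta1 p = x /\ eta2 p = y /\ coincide (similarity_candidate d p) s.
Proof.
  intros [Hxy [Hy1 [Hy2 [[u3 [v3 H3]] [[u2 [v2 H2]] [u1 [v1 H1]]]]]]].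
  split; trivial; exists (Similarity x y u1 v1 u2 v2 u3 v3).
  split; [|split]; trivial.
  split; [|split; [|split; [|split]]]; simpl.
  - intros; symmetry; now apply Hy1.
  - intros; symmetry; now apply Hy2.
  - intros z t Ht Hz; symmetry; apply H3; trivial; rewrite Hy2; trivial; lra.
  - intros z t Ht Hz; symmetry; apply H2; trivial; rewrite Hy1, Hy2; trivial; lra.
  - intros z t Ht Hz; symmetry; apply H1; trivial; rewrite Hy1; trivial; lra.
Qed.

Lemma similarity_type_candidate (d : data) (p : similarity) :
  0 < eta2 p < eta1 p ->
  similarity_type d (eta1 p) (eta2 p) (similarity_candidate d p).
Proof.
  intros Hp; split; [|split; [|split; [|split; [|split]]]]; trivial.
  - now exists (a3 p), (b3 p).
  - now exists (a2 p), (b2 p).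
  - now exists (a1 p), (b1 p).
Qed.

Lemma coincide_refl (s : candidate) : coincide s s.
Proof. repeat split. Qed.

(** The common system as real equations in the eight coefficients. The far-field and initial
    conditions both correspond to [balance_far]; the ratio [alpha1 d / alpha1 d] keeps the shape of
    [stefan_condition_iff]. *)
Record balance (d : data) (p : similarity) : Prop := {
  balance_far : a1 p + b1 p = tempD d;
  balance_value1r : a1 p + b1 p * erf (eta1 p) = tempC d;
  balance_value1l : a2 p + b2 p * erf (eta1 p * sqrt (alpha1 d / alpha2 d)) = tempC d;
  balance_value2r : a2 p + b2 p * erf (eta2 p * sqrt (alpha1 d / alpha2 d)) = tempB d;
  balance_value2l : a3 p + b3 p * erf (eta2 p * sqrt (alpha1 d / alpha3 d)) = tempB d;
  balance_stefan1 :
    k1 d * b1 p * exp (- (eta1 p ^ 2 * (alpha1 d / alpha1 d))) / sqrt (alpha1 d)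
    - k2 d * b2 p * exp (- (eta1 p ^ 2 * (alpha1 d / alpha2 d))) / sqrt (alpha2 d)
    = sqrt PI * delta1 d * sqrt (alpha1 d) * eta1 p;
  balance_stefan2 :
    k2 d * b2 p * exp (- (eta2 p ^ 2 * (alpha1 d / alpha2 d))) / sqrt (alpha2 d)
    - k3 d * b3 p * exp (- (eta2 p ^ 2 * (alpha1 d / alpha3 d))) / sqrt (alpha3 d)
    = sqrt PI * delta2 d * sqrt (alpha1 d) * eta2 p
}.

Lemma profile_free_boundary (d : data) (eta alpha a b t : R) :
  0 < alpha1 d -> 0 < alpha -> 0 < t ->
  profile alpha a b (free_boundary d eta t) t = a + b * erf (eta * sqrt (alpha1 d / alpha)).
Proof. intros; unfold profile; now rewrite free_boundary_rescaled. Qed.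

Lemma sqrt_ratio_self (a : R) : 0 < a -> sqrt (a / a) = 1.
Proof. intros; unfold Rdiv; rewrite Rinv_r by lra; apply sqrt_1. Qed.

Lemma common_system_balance (d : data) (p : similarity) (s : candidate) :
  admissible d -> 0 < eta2 p < eta1 p -> coincide (similarity_candidate d p) s ->
  common_system d s -> balance d p.
Proof.
  intros Hd Hp [E1 [E2 [F3 [F2 F1]]]] Hs; simpl in *.
  pose proof (alpha1_pos d Hd) as Ha1; pose proof (alpha2_pos d Hd) as Ha2.
  pose proof (alpha3_pos d Hd) as Ha3.
  assert (O : forall t, 0 < t -> 0 < free_boundary d (eta2 p) t
    < free_boundary d (eta1 p) t).
  { intros t Ht; split; [now apply free_boundary_pos|now apply free_boundary_increasing]. }
  (* The profiles are constant in time along the boundaries, so time [1] suffices. *)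
  pose proof (O 1 Rlt_0_1) as O1.
  pose proof (value_y1 d s Hs 1 Rlt_0_1) as [V1l V1r].
  pose proof (value_y2 d s Hs 1 Rlt_0_1) as [V2l V2r].
  rewrite <- E1 in V1l, V1r by lra; rewrite <- E2 in V2l, V2r by lra.
  rewrite <- F2 in V1l, V2r by lra; rewrite <- F3 in V2l by lra.
  rewrite <- F1 in V1r by lra.
  rewrite profile_free_boundary in V1l, V1r, V2l, V2r by lra.
  split; trivial.
  - assert (L : is_lim (fun x => Phi1 s x 1) p_infty (a1 p + b1 p)).
    { apply (is_lim_ext_loc (fun x => profile (alpha1 d) (a1 p) (b1 p) x 1)).
      - exists (free_boundary d (eta1 p) 1); intros; apply F1; lra.
      - apply is_lim_profile; lra. }
    apply is_lim_unique in L.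
    pose proof (is_lim_unique _ _ _ (far_field d s Hs 1 Rlt_0_1)) as L'.
    rewrite L in L'; now injection L'.
  - now rewrite sqrt_ratio_self, Rmult_1_r in V1r.
  (* The outer phase is unbounded; [y1 s t + 1] is an arbitrary right end. *)
  - refine (proj1 (stefan_condition_iff d (k1 d) (k2 d) (delta1 d) (alpha1 d)
      (alpha2 d) (a1 p) (b1 p) (a2 p) (b2 p) (eta1 p) (Phi1 s) (Phi2 s) (y1 s) (y2 s)
      (fun t => y1 s t + 1) Ha1 Ha1 Ha2 E1 _ _ _) (stefan1 d s Hs)).
    + intros t Ht; rewrite <- E1, <- E2 by lra; specialize (O t Ht); lra.
    + intros x t Ht Hx; apply F1; trivial; rewrite E1; lra.
    + intros x t Ht Hx; apply F2; trivial; rewrite E1, E2; lra.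
  - refine (proj1 (stefan_condition_iff d (k2 d) (k3 d) (delta2 d) (alpha2 d)
      (alpha3 d) (a2 p) (b2 p) (a3 p) (b3 p) (eta2 p) (Phi2 s) (Phi3 s) (y2 s)
      (fun _ => 0) (y1 s) Ha1 Ha2 Ha3 E2 _ _ _) (stefan2 d s Hs)).
    + intros t Ht; rewrite <- E1, <- E2 by lra; apply O; lra.
    + intros x t Ht Hx; apply F2; trivial; rewrite E1, E2; lra.
    + intros x t Ht Hx; apply F3; trivial; rewrite E2; lra.
Qed.

Lemma balance_common_system (d : data) (p : similarity) :
  admissible d -> 0 < eta2 p < eta1 p -> balance d p ->
  common_system d (similarity_candidate d p).
Proof.
  intros Hd Hp Hb.
  pose proof (alpha1_pos d Hd) as Ha1; pose proof (alpha2_pos d Hd) as Ha2.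
  pose proof (alpha3_pos d Hd) as Ha3.
  assert (O : forall t, 0 < t -> 0 < free_boundary d (eta2 p) t
    < free_boundary d (eta1 p) t).
  { intros t Ht; split; [now apply free_boundary_pos|now apply free_boundary_increasing]. }
  destruct Hb; split; simpl.
  - now apply heat_equation_profile.
  - now apply heat_equation_profile.
  - now apply heat_equation_profile.
  - intros t Ht; rewrite 2!profile_free_boundary by lra; now split.
  - intros t Ht; rewrite 2!profile_free_boundary, sqrt_ratio_self, Rmult_1_r by lra.
    now split.
  - intros x Hx; rewrite <- balance_far0; now apply filterlim_profile_initial.
  - intros t Ht; rewrite <- balance_far0; now apply is_lim_profile, Rmult_lt_0_compat.
  - apply (stefan_condition_iff d (k2 d) (k3 d) (delta2 d) (alpha2 d)
      (alpha3 d) (a2 p) (b2 p) (a3 p) (b3 p) (eta2 p) _ _ _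
      (fun _ => 0) (free_boundary d (eta1 p))); trivial.
  - apply (stefan_condition_iff d (k1 d) (k2 d) (delta1 d) (alpha1 d)
      (alpha2 d) (a1 p) (b1 p) (a2 p) (b2 p) (eta1 p) _ _ _
      (free_boundary d (eta2 p)) (fun t => free_boundary d (eta1 p) t + 1)); trivial.
    intros t Ht; specialize (O t Ht); lra.
  - unfold free_boundary; rewrite Rmult_0_r, sqrt_0; split; ring.
Qed.

(** The balance equations solved for the profile constants: [bb1] and [bb2] come from the two values
    prescribed in their phases, [bb3] from the flux at the fixed face. *)
Definition similarity_of (d : data) (x y q : R) : similarity :=
  let bb1 := - (tempC d - tempD d) / erfc x in
  let bb2 := - (tempB d - tempC d)
    / (erf (x * sqrt (alpha1 d / alpha2 d)) - erf (y * sqrt (alpha1 d / alpha2 d))) in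
  let bb3 := - (q * sqrt (PI * alpha3 d)) / k3 d in
  Similarity x y (tempD d - bb1) bb1
    (tempC d - bb2 * erf (x * sqrt (alpha1 d / alpha2 d))) bb2
    (tempB d - bb3 * erf (y * sqrt (alpha1 d / alpha3 d))) bb3.

(** Since [k1] is [rho c1 alpha1], the outer flux and the velocity term combine into [phi d x]. The
    middle slope [c] stays free so that the result can be substituted into the second Stefan
    condition. *)
Lemma stefan1_iff (d : data) (x c : R) : admissible d ->
  k1 d * (- (tempC d - tempD d) / erfc x) * exp (- (x ^ 2 * (alpha1 d / alpha1 d)))
    / sqrt (alpha1 d)
  - k2 d * c * exp (- (x ^ 2 * (alpha1 d / alpha2 d))) / sqrt (alpha2 d)
  = sqrt PI * delta1 d * sqrt (alpha1 d) * x <->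
  - k2 d * c / (sqrt (alpha2 d) * sqrt PI)
  = sqrt (alpha1 d) * delta1 d * phi d x * exp (x ^ 2 * (alpha1 d / alpha2 d)).
Proof.
  intros Hd.
  pose proof (alpha1_pos d Hd) as Ha1; pose proof (alpha2_pos d Hd) as Ha2.
  pose proof (sqrt_lt_R0 _ Ha1); pose proof (sqrt_lt_R0 _ Ha2).
  pose proof sqrt_PI_pos; pose proof (erf_lt_1 x).
  assert (Ek : k1 d = rho d * c1 d * (sqrt (alpha1 d) * sqrt (alpha1 d))).
  { rewrite sqrt_sqrt by lra; unfold alpha1; destruct Hd; field; lra. }
  replace (x ^ 2 * (alpha1 d / alpha1 d)) with (x ^ 2) by (field; lra).
  pose proof (exp_pos (x ^ 2 * (alpha1 d / alpha2 d))).
  rewrite Ek, (exp_Ropp (x ^ 2 * (alpha1 d / alpha2 d))).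
  set (e := exp (x ^ 2 * (alpha1 d / alpha2 d))) in *.
  assert (E : sqrt PI * delta1 d * sqrt (alpha1 d) * x
    - rho d * c1 d * (sqrt (alpha1 d) * sqrt (alpha1 d))
      * (- (tempC d - tempD d) / erfc x) * exp (- x ^ 2) / sqrt (alpha1 d)
    = sqrt PI * delta1 d * sqrt (alpha1 d) * phi d x).
  { unfold phi, Ste1, delta1, erfc; pose proof (l1_pos d Hd); field; lra. }
  assert (E' : - k2 d * c / (sqrt (alpha2 d) * sqrt PI)
    = - (k2 d * c * / e / sqrt (alpha2 d)) * e / sqrt PI) by (field; lra).
  assert (E'' : sqrt (alpha1 d) * delta1 d * phi d x * e
    = sqrt PI * delta1 d * sqrt (alpha1 d) * phi d x * e / sqrt PI) by (field; lra).
  rewrite E', E'', <- E.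
  set (u := k2 d * c * / e / sqrt (alpha2 d)).
  set (v := rho d * c1 d * (sqrt (alpha1 d) * sqrt (alpha1 d)) *
    (- (tempC d - tempD d) / erfc x) * exp (- x ^ 2) / sqrt (alpha1 d)).
  set (w := sqrt PI * delta1 d * sqrt (alpha1 d) * x).
  split; intros HE.
  - f_equal; f_equal; lra.
  - apply Rmult_eq_reg_r in HE; [|apply Rinv_neq_0_compat; lra].
    apply Rmult_eq_reg_r in HE; lra.
Qed.

(** With the middle slope inserted, the first Stefan condition reads
    [H_factor d = D * (phi d x * e)], where [D] is the difference of the two values of [erf];
    solving for the one at [y] produces [H d x]. *)
Lemma interface_H_iff (d : data) (x y : R) : admissible d -> 0 < y < x ->
  - k2 d * (- (tempB d - tempC d) / (erf (x * sqrt (alpha1 d / alpha2 d))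
                           - erf (y * sqrt (alpha1 d / alpha2 d))))
    / (sqrt (alpha2 d) * sqrt PI)
  = sqrt (alpha1 d) * delta1 d * phi d x * exp (x ^ 2 * (alpha1 d / alpha2 d)) <->
  erf (y * sqrt (alpha1 d / alpha2 d)) = H d x.
Proof.
  intros Hd Hxy.
  pose proof (alpha1_pos d Hd) as Ha1; pose proof (alpha2_pos d Hd) as Ha2.
  pose proof (sqrt_lt_R0 _ Ha1); pose proof (sqrt_lt_R0 _ Ha2).
  pose proof (sqrt_ratio_pos _ _ Ha1 Ha2).
  pose proof sqrt_PI_pos; pose proof (delta1_pos d Hd); pose proof (phi_gt d x Hd).
  pose proof (erf_increasing (y * sqrt (alpha1 d / alpha2 d))
    (x * sqrt (alpha1 d / alpha2 d)) ltac:(nra)).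
  pose proof (exp_pos (x ^ 2 * (alpha1 d / alpha2 d))).
  rewrite H_eq, exp_Ropp.
  set (D := erf (x * sqrt (alpha1 d / alpha2 d)) - erf (y * sqrt (alpha1 d / alpha2 d))).
  assert (HD : 0 < D) by (unfold D; lra).
  set (e := exp (x ^ 2 * (alpha1 d / alpha2 d))) in *.
  replace (- k2 d * (- (tempB d - tempC d) / D) / (sqrt (alpha2 d) * sqrt PI))
    with (sqrt (alpha1 d) * delta1 d * (H_factor d / D)).
  2:{ transitivity (sqrt (alpha1 d) * delta1 d * H_factor d / D); [field; lra|].
      rewrite H_factor_eq by trivial; field; lra. }
  transitivity (H_factor d = D * (phi d x * e)).
  - split; intros E.
    + rewrite Rmult_assoc with (r2 := phi d x) in E.
      apply Rmult_eq_reg_l in E; [|nra].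
      rewrite <- E; field; lra.
    + rewrite E; field; lra.
  - replace (H_factor d * (/ e / phi d x)) with (H_factor d / (phi d x * e))
      by (field; lra).
    assert (0 < phi d x * e) by nra.
    split; intros E.
    + rewrite E; unfold D; field; lra.
    + replace (H_factor d) with (H_factor d / (phi d x * e) * (phi d x * e))
        by (field; lra).
      f_equal; unfold D; lra.
Qed.

(** The first Stefan condition expresses the middle flux through [x], which eliminates [c]; the two
    forms then differ by the factor [sqrt PI / e]. *)
Lemma stefan2_iff (d : data) (x y q c : R) : admissible d ->
  - k2 d * c / (sqrt (alpha2 d) * sqrt PI)
  = sqrt (alpha1 d) * delta1 d * phi d x * exp (x ^ 2 * (alpha1 d / alpha2 d)) ->
  k2 d * c * exp (- (y ^ 2 * (alpha1 d / alpha2 d))) / sqrt (alpha2 d)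
  - k3 d * (- (q * sqrt (PI * alpha3 d)) / k3 d)
    * exp (- (y ^ 2 * (alpha1 d / alpha3 d))) / sqrt (alpha3 d)
  = sqrt PI * delta2 d * sqrt (alpha1 d) * y <->
  q * exp (y ^ 2 * (alpha1 d / alpha2 d - alpha1 d / alpha3 d))
  = interface_flux d x y.
Proof.
  intros Hd Hc; unfold interface_flux.
  pose proof (alpha2_pos d Hd) as Ha2; pose proof (alpha3_pos d Hd) as Ha3.
  pose proof (sqrt_lt_R0 _ Ha2); pose proof (sqrt_lt_R0 _ Ha3); pose proof sqrt_PI_pos.
  pose proof (k3_pos d Hd).
  rewrite sqrt_mult by (try apply Rlt_le, PI_RGT_0; lra).
  rewrite Rmult_plus_distr_l.
  replace (sqrt (alpha1 d) * (delta1 d * phi d x * exp (x ^ 2 * (alpha1 d / alpha2 d))))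
    with (- k2 d * c / (sqrt (alpha2 d) * sqrt PI)) by (rewrite Hc; ring).
  replace (y ^ 2 * (alpha1 d / alpha2 d - alpha1 d / alpha3 d))
    with (y ^ 2 * (alpha1 d / alpha2 d) + - (y ^ 2 * (alpha1 d / alpha3 d))) by ring.
  rewrite exp_plus, (exp_Ropp (y ^ 2 * (alpha1 d / alpha2 d))).
  pose proof (exp_pos (y ^ 2 * (alpha1 d / alpha2 d))).
  set (e := exp (y ^ 2 * (alpha1 d / alpha2 d))) in *.
  set (f := exp (- (y ^ 2 * (alpha1 d / alpha3 d)))).
  set (u := k2 d * c / (sqrt (alpha2 d) * sqrt PI)).
  replace (- k2 d * c / (sqrt (alpha2 d) * sqrt PI)) with (- u) by (unfold u; field; lra).
  replace (k2 d * c * / e / sqrt (alpha2 d)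
    - k3 d * (- (q * (sqrt PI * sqrt (alpha3 d))) / k3 d) * f / sqrt (alpha3 d))
    with ((u + q * (e * f)) * (sqrt PI / e)) by (unfold u; field; lra).
  replace (sqrt PI * delta2 d * sqrt (alpha1 d) * y)
    with (sqrt (alpha1 d) * (delta2 d * y * e) * (sqrt PI / e)) by (field; lra).
  split; intros E.
  - apply Rmult_eq_reg_r in E; [lra|].
    apply Rgt_not_eq, Rdiv_lt_0_compat; lra.
  - f_equal; lra.
Qed.

Lemma balance_similarity_of (d : data) (x y q : R) :
  admissible d -> interface_equations d x y q -> balance d (similarity_of d x y q).
Proof.
  intros Hd [Hxy EH Es].
  pose proof (sqrt_ratio_pos _ _ (alpha1_pos d Hd) (alpha2_pos d Hd)).
  pose proof (erf_lt_1 x).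
  pose proof (erf_increasing (y * sqrt (alpha1 d / alpha2 d))
    (x * sqrt (alpha1 d / alpha2 d)) ltac:(nra)).
  apply interface_H_iff in EH; trivial.
  split; simpl; try ring.
  - unfold erfc; field; lra.
  - field; lra.
  - now apply stefan1_iff.
  - now apply (stefan2_iff d x).
Qed.

Lemma balance_interface_equations (d : data) (p : similarity) :
  admissible d -> 0 < eta2 p < eta1 p -> balance d p ->
  exists q, interface_equations d (eta1 p) (eta2 p) q
    /\ p = similarity_of d (eta1 p) (eta2 p) q.
Proof.
  intros Hd Hp [B1 B2 B3 B4 B5 B6 B7]; destruct p as [x y u1 v1 u2 v2 u3 v3]; simpl in *.
  pose proof (sqrt_ratio_pos _ _ (alpha1_pos d Hd) (alpha2_pos d Hd)).
  pose proof (erf_lt_1 x).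
  pose proof (erf_increasing (y * sqrt (alpha1 d / alpha2 d))
    (x * sqrt (alpha1 d / alpha2 d)) ltac:(nra)).
  pose proof (k3_pos d Hd).
  assert (0 < sqrt (PI * alpha3 d)).
  { apply sqrt_lt_R0, Rmult_lt_0_compat; [apply PI_RGT_0|now apply alpha3_pos]. }
  (* The formula for [bb3] in [similarity_of], solved for the flux. *)
  set (q := - k3 d * v3 / sqrt (PI * alpha3 d)).
  assert (E1 : v1 = - (tempC d - tempD d) / erfc x)
    by (rewrite <- B1, <- B2; unfold erfc; field; lra).
  assert (E2 : v2 = - (tempB d - tempC d) / (erf (x * sqrt (alpha1 d / alpha2 d))
                       - erf (y * sqrt (alpha1 d / alpha2 d))))
    by (rewrite <- B3, <- B4; field; lra).
  assert (E3 : v3 = - (q * sqrt (PI * alpha3 d)) / k3 d) by (unfold q; field; lra).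
  exists q; split.
  (* [stefan2_iff] takes [B6] with the slope [v2] still in it, so [E2] is inserted only
     afterwards. *)
  - rewrite E1 in B6; apply stefan1_iff in B6; trivial.
    rewrite E3 in B7; apply (stefan2_iff d x) in B7; trivial.
    rewrite E2 in B6; apply interface_H_iff in B6; trivial.
    now split.
  - unfold similarity_of; rewrite <- E1, <- E2, <- E3; f_equal; lra.
Qed.

(** * The solutions of the two problems *)

Lemma the_solution_similarity_of (d : data) (P : candidate -> Prop) (x y q : R) :
  admissible d -> interface_equations d x y q ->
  (forall s, P s -> common_system d s) ->
  P (similarity_candidate d (similarity_of d x y q)) ->
  (forall s x' y' q', interface_equations d x' y' q' ->
     coincide (similarity_candidate d (similarity_of d x' y' q')) s -> P s ->
     (y < y' -> q' <= q) /\ (y' < y -> q <= q') /\ (y = y' -> q = q')) ->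
  the_solution d P (similarity_candidate d (similarity_of d x y q)) x y.
Proof.
  intros Hd E HP Hex Hun; split; [|split]; trivial.
  - exact (similarity_type_candidate d (similarity_of d x y q) (interface_order _ _ _ _ E)).
  - intros s x' y' Hs HPs.
    apply similarity_type_coincide in Hs; destruct Hs as [Hxy [p [<- [<- Hc]]]].
    pose proof (common_system_balance d p s Hd Hxy Hc (HP s HPs)) as Hb.
    destruct (balance_interface_equations d p Hd Hxy Hb) as [q' [E' Ep]].
    rewrite Ep in Hc.
    (* The fixed-face condition enters through [Hun]: [q] does not grow with [y] and is determined
       by it. *)
    destruct (Hun s _ _ q' E' Hc HPs) as [U1 [U2 U3]].
    destruct (interface_equations_unique d x y q _ _ q' Hd E E' U1 U2) as [Ex Ey].
    rewrite (U3 Ey), Ex, Ey; exact Hc.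
Qed.

Lemma P3_solution (d : data) (x y q : R) :
  admissible d -> interface_equations d x y q ->
  the_solution d (P3 d q) (similarity_candidate d (similarity_of d x y q)) x y.
Proof.
  intros Hd E.
  pose proof (alpha3_pos d Hd) as Ha3; pose proof (k3_pos d Hd) as Hk.
  pose proof (sqrt_lt_R0 _ Ha3); pose proof sqrt_PI_pos.
  assert (Hp : forall x y q t, 0 < t ->
    k3 d * (b3 (similarity_of d x y q) * heat_kernel (alpha3 d) 0 t) = - (q / sqrt t)).
  { intros x' y' q' t Ht; pose proof (sqrt_lt_R0 _ Ht); simpl; unfold heat_kernel.
    rewrite 2!sqrt_mult by (try apply Rlt_le, PI_RGT_0; lra).
    replace (- (0 / (2 * (sqrt (alpha3 d) * sqrt t))) ^ 2) with 0 by (field; lra).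
    rewrite exp_0; field; lra. }
  apply the_solution_similarity_of; trivial.
  - now intros s [].
  - split.
    + apply balance_common_system; [trivial|exact (interface_order _ _ _ _ E)|].
      now apply balance_similarity_of.
    + intros t Ht; eexists; split; [|now apply (Hp x y q)].
      apply (is_right_derive_iff
        (fun z => Phi3 (similarity_candidate d (similarity_of d x y q)) z t) _ 0 1
        (b3 (similarity_of d x y q) * heat_kernel (alpha3 d) 0 t)); trivial; [lra|].
      apply is_derive_profile_space, Rmult_lt_0_compat; trivial.
  - intros s x' y' q' E' [_ [E2 [F3 _]]] [_ Hs]; simpl in E2, F3.
    (* The flux at [t = 1] determines [q], which settles all three comparisons. *)
    assert (q = q'); [|lra].
    destruct (Hs 1 Rlt_0_1) as [p [Dp Ep]].
    apply (is_right_derive_iff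
      (fun z => Phi3 (similarity_candidate d (similarity_of d x' y' q')) z 1) _ 0
      (free_boundary d y' 1)
      (b3 (similarity_of d x' y' q') * heat_kernel (alpha3 d) 0 1)) in Dp.
    + rewrite Dp, (Hp x' y' q' 1 Rlt_0_1), sqrt_1 in Ep; lra.
    + destruct E'; apply free_boundary_pos; [now apply alpha1_pos|lra|lra].
    + intros z Hz; apply F3; lra.
    + apply is_derive_profile_space; lra.
Qed.

Lemma P2_solution (d : data) (x y q : R) :
  admissible d -> interface_equations d x y q ->
  the_solution d
    (P2 d (tempB d + q * sqrt (PI * alpha3 d) / k3 d
                     * erf (y * sqrt (alpha1 d / alpha3 d))))
    (similarity_candidate d (similarity_of d x y q)) x y.
Proof.
  intros Hd E.
  pose proof (alpha3_pos d Hd) as Ha3; pose proof (k3_pos d Hd) as Hk.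
  pose proof (sqrt_ratio_pos _ _ (alpha1_pos d Hd) Ha3) as Hr.
  assert (Hv : forall x y q t, Phi3 (similarity_candidate d (similarity_of d x y q)) 0 t
    = tempB d + q * sqrt (PI * alpha3 d) / k3 d
                * erf (y * sqrt (alpha1 d / alpha3 d))).
  { intros; simpl; unfold profile, Rdiv; rewrite Rmult_0_l, erf_0; field; lra. }
  (* Only the positivity of the flux is wanted, so [u + 1] is any larger coefficient. *)
  assert (Hq : forall x y q, interface_equations d x y q -> 0 < q).
  { intros u v r [Ho _ Es].
    destruct (interface_flux_increasing d u v (u + 1) v Hd ltac:(lra) ltac:(lra))
      as [Hf _].
    rewrite <- Es in Hf; pose proof (exp_pos (v ^ 2 * (alpha1 d / alpha2 d
      - alpha1 d / alpha3 d))); nra. }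
  apply the_solution_similarity_of; trivial.
  - now intros s [].
  - split.
    + apply balance_common_system; [trivial|exact (interface_order _ _ _ _ E)|].
      now apply balance_similarity_of.
    + intros t Ht; split; [apply Hv|].
      rewrite <- (Hv x y q t); eapply filterlim_filter_le_1.
      2:{ apply (ex_derive_continuous
            (fun z => Phi3 (similarity_candidate d (similarity_of d x y q)) z t)).
          eexists; now apply is_derive_profile_space, Rmult_lt_0_compat. }
      apply filter_le_within.
  - intros s x' y' q' E' [_ [E2 [F3 _]]] [_ Hs]; simpl in E2, F3.
    destruct (Hs 1 Rlt_0_1) as [Hs0 _].
    assert (Hy' : 0 < free_boundary d y' 1).
    { destruct E'; apply free_boundary_pos; [now apply alpha1_pos|lra|lra]. }
    rewrite <- F3 in Hs0 by lra.
    pose proof (Hv x' y' q' 1) as Hv'; simpl in Hv'; rewrite Hv' in Hs0.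
    assert (0 < sqrt (PI * alpha3 d) / k3 d).
    { apply Rdiv_lt_0_compat; trivial; apply sqrt_lt_R0, Rmult_lt_0_compat; trivial.
      apply PI_RGT_0. }
    (* The face temperature fixes this product; its factors being positive, a larger [y] forces a
       smaller [q]. *)
    assert (Eq : q' * erf (y' * sqrt (alpha1 d / alpha3 d))
                 = q * erf (y * sqrt (alpha1 d / alpha3 d))).
    { apply (Rmult_eq_reg_l (sqrt (PI * alpha3 d) / k3 d)); unfold Rdiv in *; lra. }
    pose proof (Hq _ _ _ E); pose proof (Hq _ _ _ E').
    destruct (interface_order _ _ _ _ E), (interface_order _ _ _ _ E').
    pose proof (erf_pos (y * sqrt (alpha1 d / alpha3 d)) ltac:(nra)).
    pose proof (erf_pos (y' * sqrt (alpha1 d / alpha3 d)) ltac:(nra)).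
    split; [|split].
    + intros Hy; pose proof (erf_increasing (y * sqrt (alpha1 d / alpha3 d))
        (y' * sqrt (alpha1 d / alpha3 d)) ltac:(nra)); nra.
    + intros Hy; pose proof (erf_increasing (y' * sqrt (alpha1 d / alpha3 d))
        (y * sqrt (alpha1 d / alpha3 d)) ltac:(nra)); nra.
    + intros <-; apply Rmult_eq_reg_r in Eq; lra.
Qed.

Theorem theorem3p8 (d : data) (Hd : admissible d)
    (z0 : R) (z0_pos : 0 < z0) (H_z0 : H d z0 = 0) :
  (forall q0 : R, q2 d z0 < q0 ->
     exists (theta : candidate) (lambda1 lambda2 : R),
       the_solution d (P3 d q0) theta lambda1 lambda2 /\
       exists (u : candidate) (mu1 mu2 : R),
         the_solution d
           (P2 d (tempB d + q0 * sqrt (PI * alpha3 d) / k3 d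
                            * erf (lambda2 * sqrt (alpha1 d / alpha3 d))))
           u mu1 mu2 /\
         coincide u theta) /\
  (forall tempA : R, tempB d < tempA ->
     exists (u : candidate) (mu1 mu2 : R),
       the_solution d (P2 d tempA) u mu1 mu2 /\
       (k3 d * (tempA - tempB d)
          / (sqrt (alpha3 d) * erf (mu2 * sqrt (alpha1 d / alpha3 d)))
        > k2 d * (tempB d - tempC d)
          / (sqrt (alpha2 d) * erf (z0 * sqrt (alpha1 d / alpha2 d))) ->
        exists (theta : candidate) (lambda1 lambda2 : R),
          the_solution d
            (P3 d (k3 d / sqrt (PI * alpha3 d)
                   * ((tempA - tempB d)
                      / erf (mu2 * sqrt (alpha1 d / alpha3 d)))))
            theta lambda1 lambda2 /\
          coincide theta u)).
Proof.
  split.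
  - intros q0 Hq.
    (* With weight [1] the datum is the flux itself and the threshold is [q2 d z0 < q0]. *)
    destruct (interface_equations_exist d z0 (fun _ => 1) q0) as [x [y E]]; trivial.
    + intros; apply continuous_const.
    + intros; lra.
    + intros; lra.
    + lra.
    + rewrite Rdiv_1_r in E.
      exists (similarity_candidate d (similarity_of d x y q0)), x, y.
      split; [now apply P3_solution|].
      exists (similarity_candidate d (similarity_of d x y q0)), x, y.
      split; [now apply P2_solution|apply coincide_refl].
  - intros tempA HA.
    pose proof (sqrt_ratio_pos _ _ (alpha1_pos d Hd) (alpha3_pos d Hd)) as Hr.
    pose proof (k3_pos d Hd) as Hk.
    assert (Hs : 0 < sqrt (PI * alpha3 d)).
    { apply sqrt_lt_R0, Rmult_lt_0_compat; [apply PI_RGT_0|now apply alpha3_pos]. }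
    (* The weight vanishes at [0], so the threshold condition becomes [0 < kappa], which is
       [tempB d < tempA]. *)
    destruct (interface_equations_exist d z0
      (fun y => erf (y * sqrt (alpha1 d / alpha3 d)))
      (k3 d / sqrt (PI * alpha3 d) * (tempA - tempB d))) as [x [y E]]; trivial.
    + intros y; apply (ex_derive_continuous
        (fun y => erf (y * sqrt (alpha1 d / alpha3 d)))).
      auto_derive; eexists; apply is_derive_erf.
    + intros y Hy; apply erf_pos; nra.
    + intros y y' [_ [Hy| ->]]; [|lra].
      left; apply erf_increasing; nra.
    + rewrite Rmult_0_l, erf_0, Rmult_0_l.
      apply Rmult_lt_0_compat; [now apply Rdiv_lt_0_compat|lra].
    + pose proof (interface_order _ _ _ _ E) as Ho.
      pose proof (erf_pos (y * sqrt (alpha1 d / alpha3 d)) ltac:(nra)) as He.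
      set (q0 := k3 d / sqrt (PI * alpha3 d)
                 * ((tempA - tempB d) / erf (y * sqrt (alpha1 d / alpha3 d)))).
      replace (k3 d / sqrt (PI * alpha3 d) * (tempA - tempB d)
               / erf (y * sqrt (alpha1 d / alpha3 d))) with q0 in E
        by (unfold q0; field; lra).
      exists (similarity_candidate d (similarity_of d x y q0)), x, y.
      split.
      (* The formulas for the two matching data are inverse to each other, so the triple with flux
         [q0] has face temperature [tempA]. *)
      * replace tempA with (tempB d + q0 * sqrt (PI * alpha3 d) / k3 d
          * erf (y * sqrt (alpha1 d / alpha3 d))) by (unfold q0; field; lra).
        now apply P2_solution.
      * intros _.
        exists (similarity_candidate d (similarity_of d x y q0)), x, y.
        split; [now apply P3_solution|apply coincide_refl].
Qed.
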